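(* Let $C$ be a coalgebra and let $\mathcal{T}_e\subseteq\mathcal{M}^C$ be the localizing subcategory associated to an idempotent $e\in C^*$. The following conditions are equivalent: (a) $\mathcal{T}_{1-e}$ is a stable subcategory. (b) $T(E_x)=E_x$ (that is, $eE_x=E_x$) for every $x\in I_e$. (c) $\operatorname{Hom}_C(E_x,E_y)=0$ for all $x\in I_e$ and $y\notin I_e$. (d) Any torsion-free vertex in $\Gamma_C$ has no torsion predecessor. (e) There is no path in $\Gamma_C$ from a vertex $S_y$ to a vertex $S_x$ such that $T(S_x)=S_x$ and $T(S_y)=0$. (f) $\mathcal{K}=\{S\in(\Gamma_C)_0\mid T(S)=S\}$ is a left link-closed subset of $(\Gamma_C)_0$, i.e., there is no arrow $S_y\to S_x$ in $\Gamma_C$ with $T(S_x)=S_x$ and $T(S_y)=0$. (g) $e$ is a right semicentral idempotent in $C^*$. (h) For every right $C$-comodule $M$, the torsion subcomodule of $M$ is $(1-e)M$. (i) $S(S_x)=S_x$ for all $x\in I_e$.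
   Context: Let $K$ be a field and $C$ a basic $K$-coalgebra (the socle of the right $C$-comodule $C$ is a direct sum of pairwise non-isomorphic simple comodules). All comodules are right comodules and $\mathcal{M}^C$ is the category of right $C$-comodules. $\{S_x\}_{x\in I_C}$ is a complete set of pairwise non-isomorphic simple right $C$-comodules, and $E_x$ is the injective envelope of $S_x$. Equalities such as $T(S_x)=S_x$ or $S(S_x)=S_x$ are understood up to isomorphism. The right Ext-quiver $\Gamma_C$ has vertex set $(\Gamma_C)_0=\{S_x\}_{x\in I_C}$ and a unique arrow $S_y\to S_x$ iff $\operatorname{Ext}^1_C(S_y,S_x)\neq 0$. It is assumed that $\Gamma_C$ is connected ($C$ is indecomposable as a coalgebra). Loewy series of a comodule $M$: $\operatorname{Soc}^1M=\operatorname{Soc}M$ and $\operatorname{Soc}^nM/\operatorname{Soc}^{n-1}M=\operatorname{Soc}(M/\operatorname{Soc}^{n-1}M)$ for $n>1$. For $n\ge 1$, $S_y$ is an $n$-predecessor of $S_x$ if $\operatorname{Ext}^1_C(S_y,\operatorname{Soc}^nE_x)\ne 0$ (equivalently $S_y$ embeds in $\operatorname{Soc}(E_x/\operatorname{Soc}^nE_x)$); $S_y$ is a predecessor of $S_x$ if it is an $n$-predecessor for some $n\geq1$. For an idempotent $e\in C^*$, $e$ acts on a right comodule $M$ by $em=\sum m_{(0)}e(m_{(1)})$, and on $C$ by $ec=\sum c_{(1)}e(c_{(2)})$, $ce=\sum e(c_{(1)})c_{(2)}$. The space $eCe$ is a coalgebra with $\Delta(ece)=\sum ec_{(1)}e\otimes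 ec_{(2)}e$ and counit the restriction of that of $C$. The quotient functor is the exact functor $T:\mathcal{M}^C\to\mathcal{M}^{eCe}$, $T(M)=eM\cong M\square_C eC$, and the section functor is its right adjoint $S:\mathcal{M}^{eCe}\to\mathcal{M}^C$, $S(N)=N\square_{eCe}Ce$. The localizing subcategory $\mathcal{T}_e$ is the class of $M$ with $T(M)=eM=0$ (torsion comodules); $\mathcal{T}_{1-e}$ is the analogous class for the idempotent $1-e$. The torsion subcomodule of $M$ is its largest torsion subcomodule (with respect to $\mathcal{T}_e$). Put $I_e=\{x\in I_C: T(S_x)\neq0\}$; the comodules $T(S_x)=S_x$, $x\in I_e$, form a complete set of simple $eCe$-comodules. A vertex $S_x$ is torsion-free if $x\in I_e$ and torsion if $x\notin I_e$. A localizing subcategory is stable if it is closed under injective envelopes. $e$ is right semicentral if $Ce=eCe$ (equivalently, $Ce$ is a subcoalgebra of $C$). *)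

(* Defs.v *)
From HB Require Import structures.
From mathcomp Require Import all_boot all_order all_algebra.
From mathcomp Require Import boolp classical_sets.
From Stdlib Require Import Relation_Operators.

Set Implicit Arguments.
Unset Strict Implicit.
Unset Printing Implicit Defensive.

Import GRing.Theory.
Local Open Scope quotient_scope.
Local Open Scope ring_scope.


Reserved Notation "V ⊗ W" (at level 40, left associativity).
Reserved Notation "v \ox w" (at level 40, left associativity).

(* V ⊗ W is the set of formal sums of pairs, two of them being identified when
   every bilinear map takes the same value on both. *)
Section TensorDef.
Variables (K : fieldType) (V W : lmodType K).

Definition bsum (U : lmodType K) (f : V -> W -> U) (s : seq (V * W)) : U :=
  \sum_(p <- s) f p.1 p.2.

Definition tens_equiv (s t : seq (V * W)) : bool :=
  `[< forall (U : lmodType K) (f : {bilinear V -> W -> U}),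
        bsum f s = bsum f t >].

Lemma tens_equiv_is_equiv : equiv_class_of tens_equiv.
Proof.
split=> [s|s t|t s u].
- exact/asboolP.
- by apply/asboolP/asboolP => h U f; rewrite h.
- by move=> /asboolP h1 /asboolP h2; apply/asboolP => U f; rewrite h1.
Qed.

Canonical tens_equiv_equiv := EquivRelPack tens_equiv_is_equiv.
Canonical tens_equiv_encModRel := defaultEncModRel tens_equiv.

Definition tensor := {eq_quot tens_equiv}.

HB.instance Definition _ : EqQuotient _ tens_equiv tensor :=
  EqQuotient.on tensor.
HB.instance Definition _ := Choice.on tensor.

Definition tlift (U : lmodType K) (f : V -> W -> U) (x : tensor) : U :=
  bsum f (repr x).

Lemma tlift_pi (U : lmodType K) (f : {bilinear V -> W -> U}) s :
  tlift f (\pi_tensor s) = bsum f s.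
Proof.
have /eqmodP/asboolP : repr (\pi_tensor s) = s %[mod tensor] by rewrite reprK.
exact.
Qed.

Lemma tlift_ext (x y : tensor) :
  (forall (U : lmodType K) (f : {bilinear V -> W -> U}),
     tlift f x = tlift f y) -> x = y.
Proof.
move=> h; rewrite -[x]reprK -[y]reprK; apply/eqmodP/asboolP => U f.
exact: h.
Qed.

Definition tens (v : V) (w : W) : tensor := \pi_tensor [:: (v, w)].
Definition tens0 : tensor := \pi_tensor [::].
Definition tens_add (x y : tensor) : tensor :=
  \pi_tensor (repr x ++ repr y).
Definition tens_scale (a : K) (x : tensor) : tensor :=
  \pi_tensor [seq (a *: p.1, p.2) | p <- repr x].
Definition tens_opp (x : tensor) : tensor := tens_scale (-1) x.

Section Lift.
Variables (U : lmodType K) (f : {bilinear V -> W -> U}).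

Lemma tlift_tens v w : tlift f (tens v w) = f v w.
Proof. by rewrite tlift_pi /bsum big_seq1. Qed.

Lemma tlift0 : tlift f tens0 = 0.
Proof. by rewrite tlift_pi /bsum big_nil. Qed.

Lemma tliftD x y : tlift f (tens_add x y) = tlift f x + tlift f y.
Proof. by rewrite tlift_pi /bsum big_cat. Qed.

Lemma tliftZ a x : tlift f (tens_scale a x) = a *: tlift f x.
Proof.
rewrite tlift_pi /bsum big_map scaler_sumr; apply: eq_bigr => p _ /=.
by rewrite linearZl_LR.
Qed.

Lemma tliftN x : tlift f (tens_opp x) = - tlift f x.
Proof. by rewrite tliftZ scaleN1r. Qed.

End Lift.

Let simp := (tlift0, tliftD, tliftZ, tliftN).

Lemma tens_addA : associative tens_add.
Proof. by move=> x y z; apply: tlift_ext => U f; rewrite !simp addrA. Qed.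
Lemma tens_addC : commutative tens_add.
Proof. by move=> x y; apply: tlift_ext => U f; rewrite !simp addrC. Qed.
Lemma tens_add0 : left_id tens0 tens_add.
Proof. by move=> x; apply: tlift_ext => U f; rewrite !simp add0r. Qed.
Lemma tens_addN : left_inverse tens0 tens_opp tens_add.
Proof. by move=> x; apply: tlift_ext => U f; rewrite !simp addNr. Qed.

HB.instance Definition _ := GRing.isZmodule.Build tensor
  tens_addA tens_addC tens_add0 tens_addN.

Lemma tens_scaleA a b x : tens_scale a (tens_scale b x) = tens_scale (a * b) x.
Proof. by apply: tlift_ext => U f; rewrite !simp scalerA. Qed.
Lemma tens_scale1 : left_id 1 tens_scale.
Proof. by move=> x; apply: tlift_ext => U f; rewrite !simp scale1r. Qed.
Lemma tens_scaleDr : right_distributive tens_scale +%R.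
Proof.
by move=> a x y; apply: tlift_ext => U f; rewrite !(simp, tliftD) scalerDr.
Qed.
Lemma tens_scaleDl x : {morph tens_scale^~ x : a b / a + b}.
Proof.
by move=> a b; apply: tlift_ext => U f; rewrite !(simp, tliftD) scalerDl.
Qed.

HB.instance Definition _ := GRing.Zmodule_isLmodule.Build K tensor
  tens_scaleA tens_scale1 tens_scaleDr tens_scaleDl.

Lemma tlift_is_linear (U : lmodType K) (f : {bilinear V -> W -> U}) :
  linear (tlift f).
Proof. by move=> a x y; rewrite tliftD tliftZ. Qed.

HB.instance Definition _ (U : lmodType K) (f : {bilinear V -> W -> U}) :=
  GRing.isLinear.Build K tensor U _ (tlift f) (tlift_is_linear f).

Lemma tens_is_bilinear : bilinear_for *:%R *:%R tens.
Proof.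
split=> [w a v v'|v a w w']; apply: tlift_ext => U f;
  rewrite tliftD tliftZ !tlift_tens.
- by rewrite linearPl.
- by rewrite linearPr.
Qed.

HB.instance Definition _ := bilinear_isBilinear.Build K V W tensor _ _ tens
  tens_is_bilinear.

End TensorDef.

Notation "V ⊗ W" := (tensor V W) : type_scope.
Notation "V ⊗ W" := (tensor V W) : ring_scope.
Notation "v \ox w" := (tens v w) : ring_scope.

Lemma tens_expand (K : fieldType) (V W : lmodType K) (x : V ⊗ W) :
  x = \sum_(p <- repr x) p.1 \ox p.2.
Proof.
apply: tlift_ext => U f; rewrite linear_sum /=.
by apply: eq_bigr => p _; rewrite tlift_tens.
Qed.

Lemma tens_lin_ext (K : fieldType) (V W U : lmodType K)
    (f g : {linear V ⊗ W -> U}) :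
  (forall v w, f (v \ox w) = g (v \ox w)) -> f =1 g.
Proof.
move=> h x; rewrite (tens_expand x) !linear_sum.
by apply: eq_bigr => p _; exact: h.
Qed.

Section TensorMaps.
Variable K : fieldType.
Implicit Types U V W : lmodType K.

Definition tmap_fun V V' W W' (f : {linear V -> V'}) (g : {linear W -> W'})
  (v : V) (w : W) : V' ⊗ W' := f v \ox g w.

Lemma tmap_fun_bilinear V V' W W' (f : {linear V -> V'})
    (g : {linear W -> W'}) : bilinear_for *:%R *:%R (tmap_fun f g).
Proof.
by split=> [w|v] a x y; rewrite /tmap_fun linearP ?linearPl ?linearPr.
Qed.

HB.instance Definition _ V V' W W' (f : {linear V -> V'})
    (g : {linear W -> W'}) :=
  bilinear_isBilinear.Build K V W (V' ⊗ W') _ _ (tmap_fun f g)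
    (tmap_fun_bilinear f g).

Definition tmap V V' W W' (f : {linear V -> V'}) (g : {linear W -> W'}) :
  {linear V ⊗ W -> V' ⊗ W'} := tlift (tmap_fun f g).

Lemma tmapE V V' W W' (f : {linear V -> V'}) (g : {linear W -> W'}) v w :
  tmap f g (v \ox w) = f v \ox g w.
Proof. exact: (tlift_tens (tmap_fun f g)). Qed.

Lemma tens_linr V W (v : V) : linear (@tens K V W v).
Proof. by move=> a x y; rewrite linearPr. Qed.
HB.instance Definition _ V W (v : V) :=
  GRing.isLinear.Build K W (V ⊗ W) _ (tens v) (@tens_linr V W v).

Definition tassoc_fun1 U V W (w : W) (u : U) (v : V) : U ⊗ (V ⊗ W) :=
  u \ox (v \ox w).
Lemma tassoc_fun1_bilinear U V W (w : W) :
  bilinear_for *:%R *:%R (@tassoc_fun1 U V W w).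
Proof.
by split=> [v|u] a x y; rewrite /tassoc_fun1 ?linearPl ?linearPr.
Qed.
HB.instance Definition _ U V W (w : W) :=
  bilinear_isBilinear.Build K U V (U ⊗ (V ⊗ W)) _ _
    (@tassoc_fun1 U V W w) (@tassoc_fun1_bilinear U V W w).

Definition tassoc_fun U V W (x : U ⊗ V) (w : W) : U ⊗ (V ⊗ W) :=
  tlift (tassoc_fun1 w) x.
Lemma tassoc_fun_bilinear U V W :
  bilinear_for *:%R *:%R (@tassoc_fun U V W).
Proof.
split=> [w|x] a y z; first by rewrite /tassoc_fun linearP.
rewrite /tassoc_fun /tlift /bsum /= scaler_sumr -big_split /=; apply: eq_bigr => p _.
by rewrite /tassoc_fun1 !linearPr.
Qed.
HB.instance Definition _ U V W :=
  bilinear_isBilinear.Build K (U ⊗ V) W (U ⊗ (V ⊗ W)) _ _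
    (@tassoc_fun U V W) (@tassoc_fun_bilinear U V W).

Definition tassoc U V W : {linear (U ⊗ V) ⊗ W -> U ⊗ (V ⊗ W)} :=
  tlift (@tassoc_fun U V W).
Lemma tassocE U V W (u : U) (v : V) (w : W) :
  tassoc U V W ((u \ox v) \ox w) = u \ox (v \ox w).
Proof.
rewrite [LHS](tlift_tens (@tassoc_fun U V W)) /tassoc_fun.
exact: (tlift_tens (tassoc_fun1 w)).
Qed.

(* id ⊗ phi and phi ⊗ id followed by V ⊗ K = V and K ⊗ W = W *)
Definition rcontr_fun V W (phi : {scalar W}) (v : V) (w : W) : V :=
  phi w *: v.
Lemma rcontr_fun_bilinear V W (phi : {scalar W}) :
  bilinear_for *:%R *:%R (@rcontr_fun V W phi).
Proof.
split=> [w|v] a x y; rewrite /rcontr_fun.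
  by rewrite /= scalerDr !scalerA mulrC.
by rewrite linearP /= scalerDl scalerA.
Qed.
HB.instance Definition _ V W (phi : {scalar W}) :=
  bilinear_isBilinear.Build K V W V _ _ (@rcontr_fun V W phi)
    (@rcontr_fun_bilinear V W phi).
Definition rcontr V W (phi : {scalar W}) : {linear V ⊗ W -> V} :=
  tlift (@rcontr_fun V W phi).
Lemma rcontrE V W (phi : {scalar W}) (v : V) w :
  rcontr V phi (v \ox w) = phi w *: v.
Proof. exact: (tlift_tens (@rcontr_fun V W phi)). Qed.

Definition lcontr_fun V W (phi : {scalar V}) (v : V) (w : W) : W :=
  phi v *: w.
Lemma lcontr_fun_bilinear V W (phi : {scalar V}) :
  bilinear_for *:%R *:%R (@lcontr_fun V W phi).
Proof.
split=> [w|v] a x y; rewrite /lcontr_fun.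
  by rewrite /= linearP /= scalerDl scalerA.
by rewrite /= scalerDr !scalerA mulrC.
Qed.
HB.instance Definition _ V W (phi : {scalar V}) :=
  bilinear_isBilinear.Build K V W W _ _ (@lcontr_fun V W phi)
    (@lcontr_fun_bilinear V W phi).
Definition lcontr V W (phi : {scalar V}) : {linear V ⊗ W -> W} :=
  tlift (@lcontr_fun V W phi).
Lemma lcontrE V W (phi : {scalar V}) v (w : W) :
  lcontr W phi (v \ox w) = phi v *: w.
Proof. exact: (tlift_tens (@lcontr_fun V W phi)). Qed.

End TensorMaps.

Definition mklin (K : fieldType) (V U : lmodType K) (f : V -> U)
    (h : linear f) : {linear V -> U} :=
  HB.pack f (GRing.isLinear.Build K V U *:%R f h).

(* Vector subspaces of V are the members of submodClosed V. *)

Section Subspace.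
Variables (K : fieldType) (V : lmodType K) (N : submodClosed V).

Record subsp := Subsp { subval : V; _ : subval \in N }.

HB.instance Definition _ := [isSub for subval].
HB.instance Definition _ := [Choice of subsp by <:].
HB.instance Definition _ := [SubChoice_isSubLmodule of subsp by <:].

Lemma subvalP (x : subsp) : subval x \in N.
Proof. exact: (valP x). Qed.

Lemma subval_inj : injective subval.
Proof. exact: val_inj. Qed.

Lemma subval_is_linear : linear subval.
Proof. by []. Qed.

Definition incl : {linear subsp -> V} := mklin subval_is_linear.

Lemma inclE x : incl x = subval x. Proof. by []. Qed.

Lemma submod_opp x : x \in N -> - x \in N.
Proof. by move=> h; rewrite -scaleN1r; exact: rpredZ. Qed.

Lemma submod_sub x y : x \in N -> y \in N -> x - y \in N.
Proof. by move=> hx hy; apply: rpredD => //; exact: submod_opp. Qed.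

Definition quot_equiv (x y : V) : bool := x - y \in N.

Lemma quot_equiv_is_equiv : equiv_class_of quot_equiv.
Proof.
split=> [x|x y|y x z]; rewrite /quot_equiv; first by rewrite subrr rpred0.
  by apply/idP/idP => /submod_opp; rewrite opprB.
by move=> h1 h2; rewrite -[x](addrNK y) -addrA; exact: rpredD.
Qed.

Canonical quot_equiv_equiv := EquivRelPack quot_equiv_is_equiv.
Canonical quot_equiv_encModRel := defaultEncModRel quot_equiv.

Definition quotsp := {eq_quot quot_equiv}.

HB.instance Definition _ : EqQuotient _ quot_equiv quotsp :=
  EqQuotient.on quotsp.
HB.instance Definition _ := Choice.on quotsp.

Definition qpi (x : V) : quotsp := \pi_quotsp x.

Lemma qpiP x y : reflect (qpi x = qpi y) (x - y \in N).
Proof. by apply: (iffP idP) => [h|/eqmodP //]; apply/eqmodP. Qed.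

Lemma qpiK x : qpi (repr x) = x.
Proof. exact: reprK. Qed.

Lemma repr_qpi x : repr (qpi x) - x \in N.
Proof. by apply/qpiP; rewrite qpiK. Qed.

Definition quot_add (x y : quotsp) : quotsp := qpi (repr x + repr y).
Definition quot_scale (a : K) (x : quotsp) : quotsp := qpi (a *: repr x).

Lemma quot_addE x y : quot_add (qpi x) (qpi y) = qpi (x + y).
Proof.
by apply/qpiP; rewrite opprD addrACA; apply: rpredD; exact: repr_qpi.
Qed.

Lemma quot_scaleE a x : quot_scale a (qpi x) = qpi (a *: x).
Proof. by apply/qpiP; rewrite -scalerBr; apply: rpredZ; exact: repr_qpi. Qed.

Lemma quot_addA : associative quot_add.
Proof.
by move=> x y z; rewrite -[x]qpiK -[y]qpiK -[z]qpiK !quot_addE addrA.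
Qed.
Lemma quot_addC : commutative quot_add.
Proof. by move=> x y; rewrite -[x]qpiK -[y]qpiK !quot_addE addrC. Qed.
Lemma quot_add0 : left_id (qpi 0) quot_add.
Proof. by move=> x; rewrite -[x]qpiK quot_addE add0r. Qed.
Lemma quot_addN : left_inverse (qpi 0) (quot_scale (-1)) quot_add.
Proof.
by move=> x; rewrite -[x]qpiK quot_scaleE quot_addE scaleN1r addNr.
Qed.

HB.instance Definition _ := GRing.isZmodule.Build quotsp
  quot_addA quot_addC quot_add0 quot_addN.

Lemma quot_scaleA a b x : quot_scale a (quot_scale b x) = quot_scale (a * b) x.
Proof. by rewrite -[x]qpiK !quot_scaleE scalerA. Qed.
Lemma quot_scale1 : left_id 1 quot_scale.
Proof. by move=> x; rewrite -[x]qpiK !quot_scaleE scale1r. Qed.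
Lemma qpiD x y : qpi x + qpi y = qpi (x + y).
Proof. exact: quot_addE. Qed.
Lemma quot_scaleDr : right_distributive quot_scale +%R.
Proof.
move=> a x y; rewrite -[x]qpiK -[y]qpiK qpiD !quot_scaleE qpiD.
by rewrite scalerDr.
Qed.
Lemma quot_scaleDl x : {morph quot_scale^~ x : a b / a + b}.
Proof. by move=> a b; rewrite -[x]qpiK !quot_scaleE qpiD scalerDl. Qed.

HB.instance Definition _ := GRing.Zmodule_isLmodule.Build K quotsp
  quot_scaleA quot_scale1 quot_scaleDr quot_scaleDl.

Lemma qpi_is_linear : linear qpi.
Proof.
by move=> a x y; rewrite -qpiD -quot_scaleE.
Qed.

Definition qproj : {linear V -> quotsp} := mklin qpi_is_linear.

Lemma qproj_eq0 x : (qproj x == 0) = (x \in N).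
Proof. by apply/eqP/idP => [/qpiP|h]; last apply/qpiP; rewrite subr0. Qed.

Lemma qproj_surj y : exists x, qproj x = y.
Proof. by exists (repr y); exact: qpiK. Qed.

End Subspace.

Section ImageKernel.
Variables (K : fieldType) (V W : lmodType K) (f : {linear V -> W}).

Definition imsp_pred : {pred W} := fun w => `[< exists v, f v = w >].
Lemma imsp_closed : subsemimod_closed imsp_pred.
Proof.
split; first split.
- by apply/asboolP; exists 0; rewrite linear0.
- move=> _ _ /asboolP[x <-] /asboolP[y <-]; apply/asboolP.
  by exists (x + y); rewrite linearD.
- move=> a _ /asboolP[x <-]; apply/asboolP.
  by exists (a *: x); rewrite linearZ.
Qed.
HB.instance Definition _ := GRing.isSubmodClosed.Build K W imsp_pred imsp_closed.
Definition imsp : submodClosed W := imsp_pred.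

Lemma imspP w : reflect (exists v, f v = w) (w \in imsp).
Proof. exact: asboolP. Qed.

Definition kersp_pred : {pred V} := fun v => f v == 0.
Lemma kersp_closed : subsemimod_closed kersp_pred.
Proof.
split; first split.
- by rewrite unfold_in /kersp_pred linear0.
- move=> x y; rewrite !unfold_in /kersp_pred => /eqP hx /eqP hy.
  by rewrite linearD hx hy addr0.
- move=> a x; rewrite !unfold_in /kersp_pred => /eqP hx.
  by rewrite linearZ /= hx scaler0.
Qed.
HB.instance Definition _ := GRing.isSubmodClosed.Build K V kersp_pred kersp_closed.
Definition kersp : submodClosed V := kersp_pred.

Lemma kerspP v : reflect (f v = 0) (v \in kersp).
Proof. exact: eqP. Qed.

End ImageKernel.

Section SumOfSubspaces.
Variables (K : fieldType) (V : lmodType K) (F : submodClosed V -> Prop).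

Definition sumsp_pred : {pred V} := fun v =>
  `[< exists s : seq V,
        (forall x, x \in s -> exists2 N : submodClosed V, F N & x \in N)
        /\ v = \sum_(x <- s) x >].
Lemma sumsp_closed : subsemimod_closed sumsp_pred.
Proof.
split; first split.
- by apply/asboolP; exists [::]; rewrite big_nil.
- move=> _ _ /asboolP[s [hs ->]] /asboolP[t [ht ->]]; apply/asboolP.
  exists (s ++ t); rewrite big_cat; split=> // x.
  by rewrite mem_cat => /orP[/hs|/ht].
- move=> a _ /asboolP[s [hs ->]]; apply/asboolP.
  exists [seq a *: x | x <- s]; rewrite big_map scaler_sumr; split=> //.
  move=> _ /mapP[x /hs[N FN xN] ->]; exists N => //; exact: rpredZ.
Qed.
HB.instance Definition _ :=
  GRing.isSubmodClosed.Build K V sumsp_pred sumsp_closed.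
Definition sumsp : submodClosed V := sumsp_pred.

Lemma sumspP v : reflect (exists s : seq V,
    (forall x, x \in s -> exists2 N : submodClosed V, F N & x \in N)
    /\ v = \sum_(x <- s) x) (v \in sumsp).
Proof. exact: asboolP. Qed.

End SumOfSubspaces.

Section Preimage.
Variables (K : fieldType) (V W : lmodType K) (f : {linear V -> W}).
Variable N : submodClosed W.

Definition preim_pred : {pred V} := fun v => f v \in N.
Lemma preim_closed : subsemimod_closed preim_pred.
Proof.
split; first split.
- have -> : (0 \in preim_pred) = (f 0 \in N) by [].
  by rewrite linear0 rpred0.
- move=> x y hx hy; have -> : (x + y \in preim_pred) = (f (x + y) \in N) by [].
  by rewrite linearD; exact: rpredD.
- move=> a x hx; have -> : (a *: x \in preim_pred) = (f (a *: x) \in N) by [].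
  by rewrite linearZ; exact: rpredZ.
Qed.
HB.instance Definition _ :=
  GRing.isSubmodClosed.Build K V preim_pred preim_closed.
Definition preimsp : submodClosed V := preim_pred.

Lemma in_preimsp v : (v \in preimsp) = (f v \in N).
Proof. by []. Qed.

End Preimage.

Lemma exists_complement (K : fieldType) (V : lmodType K) (N : submodClosed V) :
  exists A : set V,
    [/\ forall a x y, A x -> A y -> A (a *: x + y), A 0,
        forall x, A x -> x \in N -> x = 0
      & forall v, exists n p, [/\ n \in N, A p & v = n + p]].
Proof.
pose P : set (set V) := fun A =>
  (forall a x y, A x -> A y -> A (a *: x + y)) /\
  (forall x, A x -> x \in N -> x = 0).
have [F FP Ftot|A [[Acl AN] Amax]] := @Zorn_bigcup V P.
  split=> [a x y [X FX Xx] [Y FY Yy]|x [X FX Xx] xN]; last first.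
    by have [_ h] := FP _ FX; exact: h.
  have [hX _] := FP _ FX; have [hY _] := FP _ FY.
  have [XY|YX] := Ftot _ _ FX FY.
    by exists Y => //; apply: hY => //; exact: XY.
  by exists X => //; apply: hX => //; exact: YX.
have nsub B : (A `<=` B)%classic -> P B -> (B `<=` A)%classic.
  move=> AB PB; apply: contrapT => nBA; exact: (Amax B (conj AB nBA) PB).
have A0 : A 0.
  have h : P [set x | A x \/ x = 0]%classic.
    split=> [a x y /= [Ax|->] [Ay|->]|x /= [Ax xN|->//]]; last exact: AN.
    - by left; exact: Acl.
    - left; have := Acl (a - 1) x x Ax Ax.
      by rewrite -[X in _ + X]scale1r -scalerDl subrK addr0.
    - by left; rewrite scaler0 add0r.
    - by right; rewrite scaler0 add0r.
  by apply: (nsub _ _ h) => /= [x Ax|]; [left|right].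
exists A; split=> // v; apply: contrapT => nv.
pose B : set V := fun w => exists a p, A p /\ w = p + a *: v.
have PB : P B.
  split=> [c x y [a [p [Ap ->]]] [b [q [Aq ->]]]|x [a [p [Ap ->]]] xN].
    exists (c * a + b), (c *: p + q); split; first exact: Acl.
    by rewrite scalerDr scalerA addrACA scalerDl.
  have [a0|an0] := eqVneq a 0.
    by move: xN; rewrite a0 scale0r addr0; exact: AN.
  case: nv; exists (a^-1 *: (p + a *: v)), (- a^-1 *: p + 0); split.
  - exact: rpredZ.
  - exact: Acl.
  - rewrite addr0 scalerDr scalerA mulVf // scale1r scaleNr addrAC subrr.
    by rewrite add0r.
have AB : (A `<=` B)%classic.
  by move=> w Aw; exists 0, w; rewrite scale0r addr0.
have Av : A v.
  by apply: (nsub _ AB PB); exists 1, 0; rewrite scale1r add0r.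
by apply: nv; exists 0, v; rewrite add0r; split=> //; exact: rpred0.
Qed.

Lemma lin_factor (K : fieldType) (A B U : lmodType K)
    (f : {linear A -> B}) (h : {linear A -> U}) :
  (forall a, f a = 0 -> h a = 0) ->
  exists s : {linear B -> U}, forall a, s (f a) = h a.
Proof.
move=> kfh; have [P [Pcl P0 PN dec]] := exists_complement (imsp f).
have hf a a' : f a = f a' -> h a = h a'.
  move=> faa'; apply/eqP; rewrite -subr_eq0 -linearB; apply/eqP/kfh.
  by rewrite linearB faa' subrr.
have decf b : exists a, P (b - f a).
  have [_ [p [/imspP[a <-] Pp ->]]] := dec b.
  by exists a; rewrite addrAC subrr add0r.
pose g b := sval (cid (decf b)).
have gP b : P (b - f (g b)) by rewrite /g; case: cid.
have uniq b a : P (b - f a) -> f (g b) = f a.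
  move=> Pa; apply/eqP; rewrite -subr_eq0; apply/eqP; apply: PN.
    by have := Pcl (-1) _ _ (gP b) Pa; rewrite scaleN1r opprB addrA subrK.
  by apply/imspP; exists (g b - a); rewrite linearB.
have lin : linear (fun b => h (g b)).
  move=> c x y; rewrite -linearP; apply: hf; apply: uniq.
  rewrite linearP opprD addrACA -scalerBr; exact: Pcl.
exists (mklin lin) => a /=; apply: hf; apply: uniq.
by rewrite subrr.
Qed.

Section TmapFacts.
Variable K : fieldType.
Implicit Types U V W : lmodType K.

Lemma tmap_comp U V W U' V' W' (f : {linear U -> V}) (f' : {linear V -> W})
    (g : {linear U' -> V'}) (g' : {linear V' -> W'}) x :
  tmap f' g' (tmap f g x) = tmap (f' \o f) (g' \o g) x.
Proof.
move: x; apply: (tens_lin_ext (f := tmap f' g' \o tmap f g)) => v w /=.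
by rewrite !tmapE.
Qed.

Lemma tmap_eq V V' W W' (f f' : {linear V -> V'}) (g g' : {linear W -> W'}) :
  f =1 f' -> g =1 g' -> tmap f g =1 tmap f' g'.
Proof.
by move=> ff' gg'; apply: tens_lin_ext => v w; rewrite !tmapE ff' gg'.
Qed.

Lemma tmap_id V W x : tmap (idfun : {linear V -> V})
  (idfun : {linear W -> W}) x = x.
Proof.
move: x; apply: (tens_lin_ext (g := idfun)) => v w; exact: tmapE.
Qed.

Lemma tmap_injl V V' W (f : {linear V -> V'}) :
  injective f -> injective (tmap f (idfun : {linear W -> W})).
Proof.
move=> fi; have [|s sf] := @lin_factor K V V' V f idfun.
  by move=> a fa0; apply: fi; rewrite fa0 linear0.
apply: (can_inj (g := tmap s idfun)) => x.
rewrite tmap_comp -[RHS]tmap_id; apply: tmap_eq => //; exact: sf.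
Qed.

Lemma tmap_kerl V V' W (f : {linear V -> V'}) x :
  tmap f (idfun : {linear W -> W}) x = 0 ->
  x \in imsp (tmap (incl (kersp f)) (idfun : {linear W -> W})).
Proof.
move=> fx0.
have [|r rK] := @lin_factor K _ V (subsp (kersp f)) (incl (kersp f)) idfun.
  by move=> a a0; apply: subval_inj; rewrite -inclE a0.
have [|s sf] := @lin_factor K V V' V f (idfun \- (incl (kersp f) \o r)).
  move=> a fa0 /=; have ak : a \in kersp f by apply/kerspP.
  have := rK (Subsp ak); rewrite inclE /= => ->; exact: subrr.
apply/imspP; exists (tmap r idfun x).
have xE : x = tmap (incl (kersp f)) idfun (tmap r idfun x)
            + tmap s idfun (tmap f idfun x).
  rewrite !tmap_comp.
  pose F := tmap (incl (kersp f) \o r) (idfun \o (idfun : {linear W -> W})).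
  pose G := tmap (s \o f) (idfun \o (idfun : {linear W -> W})).
  clear fx0; move: x; apply: (tens_lin_ext (f := idfun) (g := F \+ G)) => v w /=.
  by rewrite /F /G !tmapE /= sf /= linearBl addrC subrK.
by rewrite [RHS]xE fx0 linear0 addr0.
Qed.

End TmapFacts.

Section Assoc.
Variable K : fieldType.
Implicit Types U V W X : lmodType K.

Lemma tens3_ext U V W X (f g : {linear (U ⊗ V) ⊗ W -> X}) :
  (forall u v w, f ((u \ox v) \ox w) = g ((u \ox v) \ox w)) -> f =1 g.
Proof.
move=> h; apply: tens_lin_ext => x w; rewrite (tens_expand x).
rewrite linear_sumlz.
by rewrite [LHS]linear_sum [RHS]linear_sum; apply: eq_bigr => p _; exact: h.
Qed.

Lemma tens3_ext' U V W X (f g : {linear U ⊗ (V ⊗ W) -> X}) :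
  (forall u v w, f (u \ox (v \ox w)) = g (u \ox (v \ox w))) -> f =1 g.
Proof.
move=> h; apply: tens_lin_ext => u x; rewrite (tens_expand x).
rewrite linear_sumr [LHS]linear_sum [RHS]linear_sum.
by apply: eq_bigr => p _; exact: h.
Qed.

Definition tassocV_fun1 U V W (u : U) (v : V) (w : W) : (U ⊗ V) ⊗ W :=
  (u \ox v) \ox w.
Lemma tassocV_fun1_bilinear U V W (u : U) :
  bilinear_for *:%R *:%R (@tassocV_fun1 U V W u).
Proof.
split=> [w|v] a x y; rewrite /tassocV_fun1 /=.
  by rewrite linearPr linearPl.
by rewrite linearPr.
Qed.
HB.instance Definition _ U V W (u : U) :=
  bilinear_isBilinear.Build K V W ((U ⊗ V) ⊗ W) _ _
    (@tassocV_fun1 U V W u) (@tassocV_fun1_bilinear U V W u).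

Definition tassocV_fun U V W (u : U) (x : V ⊗ W) : (U ⊗ V) ⊗ W :=
  tlift (tassocV_fun1 u) x.
Lemma tassocV_fun_bilinear U V W :
  bilinear_for *:%R *:%R (@tassocV_fun U V W).
Proof.
split=> [x|u] a y z; last by rewrite /tassocV_fun linearP.
rewrite /tassocV_fun /tlift /bsum /= scaler_sumr -big_split /=.
by apply: eq_bigr => p _; rewrite /tassocV_fun1 !linearPl.
Qed.
HB.instance Definition _ U V W :=
  bilinear_isBilinear.Build K U (V ⊗ W) ((U ⊗ V) ⊗ W) _ _
    (@tassocV_fun U V W) (@tassocV_fun_bilinear U V W).

Definition tassocV U V W : {linear U ⊗ (V ⊗ W) -> (U ⊗ V) ⊗ W} :=
  tlift (@tassocV_fun U V W).
Lemma tassocVE U V W (u : U) (v : V) (w : W) :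
  tassocV U V W (u \ox (v \ox w)) = (u \ox v) \ox w.
Proof.
rewrite [LHS](tlift_tens (@tassocV_fun U V W)) /tassocV_fun.
exact: (tlift_tens (tassocV_fun1 u)).
Qed.

Lemma tassocK U V W : cancel (tassoc U V W) (tassocV U V W).
Proof.
move=> x; move: x; apply: (tens3_ext (f := tassocV U V W \o tassoc U V W)
  (g := idfun)) => u v w /=.
by rewrite tassocE tassocVE.
Qed.

Lemma tassocVK U V W : cancel (tassocV U V W) (tassoc U V W).
Proof.
move=> x; move: x; apply: (tens3_ext' (f := tassoc U V W \o tassocV U V W)
  (g := idfun)) => u v w /=.
by rewrite tassocVE tassocE.
Qed.

Lemma tassoc_nat U V W U' V' W' (f : {linear U -> U'}) (g : {linear V -> V'})
    (h : {linear W -> W'}) x :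
  tassoc _ _ _ (tmap (tmap f g) h x) = tmap f (tmap g h) (tassoc _ _ _ x).
Proof.
move: x; apply: (tens3_ext (f := tassoc _ _ _ \o tmap (tmap f g) h)
  (g := tmap f (tmap g h) \o tassoc _ _ _)) => u v w /=.
by rewrite !(tmapE, tassocE).
Qed.

Lemma tmap_rcontr V V' W (f : {linear V -> V'}) (phi : {scalar W}) x :
  rcontr V' phi (tmap f idfun x) = f (rcontr V phi x).
Proof.
move: x; apply: (tens_lin_ext (f := rcontr _ phi \o tmap f idfun)
  (g := f \o rcontr _ phi)) => v w /=.
by rewrite tmapE !rcontrE linearZ.
Qed.

Lemma rcontr_tmap V W W' (g : {linear W -> W'}) (phi : {scalar W'}) x :
  rcontr V phi (tmap idfun g x) = rcontr V (phi \o g) x.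
Proof.
move: x; apply: (tens_lin_ext (f := rcontr _ phi \o tmap idfun g)
  (g := rcontr _ (phi \o g))) => v w /=.
by rewrite tmapE !rcontrE.
Qed.

Lemma tmap_lcontr V W W' (g : {linear W -> W'}) (phi : {scalar V}) x :
  lcontr W' phi (tmap idfun g x) = g (lcontr W phi x).
Proof.
move: x; apply: (tens_lin_ext (f := lcontr _ phi \o tmap idfun g)
  (g := g \o lcontr _ phi)) => v w /=.
by rewrite tmapE !lcontrE linearZ.
Qed.

Lemma lcontr_tmap V V' W (f : {linear V -> V'}) (phi : {scalar V'}) x :
  lcontr W phi (tmap f idfun x) = lcontr W (phi \o f) x.
Proof.
move: x; apply: (tens_lin_ext (f := lcontr _ phi \o tmap f idfun)
  (g := lcontr _ (phi \o f))) => v w /=.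
by rewrite tmapE !lcontrE.
Qed.

Lemma rcontr_assoc U V W (phi : {scalar W}) (x : (U ⊗ V) ⊗ W) :
  tmap idfun (rcontr V phi) (tassoc U V W x) = rcontr (U ⊗ V) phi x.
Proof.
move: x; apply: (tens3_ext (f := tmap idfun (rcontr V phi) \o tassoc U V W)
  (g := rcontr _ phi)) => u v w /=.
by rewrite tassocE tmapE !rcontrE linearZr_LR.
Qed.

Lemma lcontr_assoc U V W (phi : {scalar U}) (x : (U ⊗ V) ⊗ W) :
  lcontr (V ⊗ W) phi (tassoc U V W x) = tmap (lcontr V phi) idfun x.
Proof.
move: x; apply: (tens3_ext (f := lcontr (V ⊗ W) phi \o tassoc U V W)
  (g := tmap (lcontr V phi) idfun)) => u v w /=.
by rewrite tassocE tmapE !lcontrE linearZl_LR.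
Qed.

Lemma mcontr_assoc U V W (phi : {scalar V}) (x : (U ⊗ V) ⊗ W) :
  tmap idfun (lcontr W phi) (tassoc U V W x) = tmap (rcontr U phi) idfun x.
Proof.
move: x; apply: (tens3_ext (f := tmap idfun (lcontr W phi) \o tassoc U V W)
  (g := tmap (rcontr U phi) idfun)) => u v w /=.
by rewrite tassocE !tmapE lcontrE rcontrE linearZr_LR linearZl_LR.
Qed.

Lemma lrcontr V W (phi : {scalar V}) (psi : {scalar W}) x :
  phi (rcontr V psi x) = psi (lcontr W phi x).
Proof.
move: x; apply: (tens_lin_ext (f := (phi : {linear V -> K^o}) \o rcontr V psi)
  (g := (psi : {linear W -> K^o}) \o lcontr W phi)) => v w /=.
rewrite rcontrE lcontrE !linearZ /=; exact: mulrC.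
Qed.

End Assoc.

Record coalgebra (K : fieldType) := Coalgebra {
  coalg_sort :> lmodType K;
  comul : {linear coalg_sort -> coalg_sort ⊗ coalg_sort};
  counit : {scalar coalg_sort};
  comulA : forall c, tassoc _ _ _ (tmap comul idfun (comul c))
                     = tmap idfun comul (comul c);
  counit_comull : forall c, lcontr _ counit (comul c) = c;
  counit_comulr : forall c, rcontr _ counit (comul c) = c }.

Arguments comul {K} C : rename.
Arguments counit {K} C : rename.

(* Comodules are right comodules. *)
Record comodule (K : fieldType) (C : coalgebra K) := Comodule {
  comod_sort :> lmodType K;
  coact : {linear comod_sort -> comod_sort ⊗ C};
  coactA : forall m, tassoc _ _ _ (tmap coact idfun (coact m))
                     = tmap idfun (comul C) (coact m);
  counit_coact : forall m, rcontr _ (counit C) (coact m) = m }.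

Arguments coact {K C} M : rename.

Section Comodules.
Variables (K : fieldType) (C : coalgebra K).
Implicit Types M N P : comodule C.

Definition regular_comod : comodule C :=
  @Comodule K C C (comul C) (@comulA K C) (@counit_comulr K C).

Definition is_chom M N (f : {linear M -> N}) : Prop :=
  forall m, coact N (f m) = tmap f idfun (coact M m).

Record chom M N := Chom {
  chom_fun :> {linear M -> N};
  chomP : is_chom chom_fun }.

Definition comod_iso M N : Prop := exists f : chom M N, bijective f.

Definition is_subcomod M (N : submodClosed M) : Prop :=
  forall m, m \in N -> coact M m \in imsp (tmap (incl N) (idfun : {linear C -> C})).

Record subcomod M := Subcomod {
  subcomod_sp :> submodClosed M;
  subcomodP : is_subcomod subcomod_sp }.

Lemma imsp_tmap_inclS (V W : lmodType K) (N N' : submodClosed V) x :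
  (forall v, v \in N -> v \in N') ->
  x \in imsp (tmap (incl N) (idfun : {linear W -> W})) ->
  x \in imsp (tmap (incl N') (idfun : {linear W -> W})).
Proof.
move=> NN' /imspP[y <-].
have lin : linear (fun n : subsp N => Subsp (NN' _ (subvalP n))).
  by move=> a u v; exact: subval_inj.
apply/imspP; exists (tmap (mklin lin) idfun y).
by rewrite tmap_comp; apply: tmap_eq.
Qed.

(* The comodule carried by a subcomodule: its coaction is the unique one which
   makes the inclusion a comodule map. *)
Section SubComodule.
Variables (M : comodule C) (N : subcomod M).

Lemma subcoact_exists :
  exists h : {linear subsp N -> subsp N ⊗ C},
    forall n, tmap (incl N) idfun (h n) = coact M (incl N n).
Proof.
have [|r rK] := @lin_factor K _ M (subsp N) (incl N) idfun.
  by move=> a a0; apply: subval_inj; rewrite -inclE a0.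
exists (tmap r idfun \o (coact M \o incl N)) => n /=.
have /imspP[y <-] := subcomodP (subvalP n); rewrite !tmap_comp.
by apply: tmap_eq => // u; rewrite /= rK.
Qed.

Definition subcoact : {linear subsp N -> subsp N ⊗ C} :=
  sval (cid subcoact_exists).

Lemma subcoactE n : tmap (incl N) idfun (subcoact n) = coact M (incl N n).
Proof. by rewrite /subcoact; case: cid. Qed.

Lemma subcoactA n : tassoc _ _ _ (tmap subcoact idfun (subcoact n))
                    = tmap idfun (comul C) (subcoact n).
Proof.
apply: (tmap_injl (f := incl N) (@subval_inj _ _ N)).
transitivity (tassoc _ _ _ (tmap (coact M) idfun (coact M (incl N n)))).
  transitivity (tmap (incl N) (tmap idfun idfun)
                  (tassoc _ _ _ (tmap subcoact idfun (subcoact n)))).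
    by apply: tmap_eq => // u; rewrite tmap_id.
  rewrite -tassoc_nat tmap_comp -subcoactE tmap_comp; congr (tassoc _ _ _ _).
  by apply: tmap_eq => // u; exact: subcoactE.
by rewrite coactA -subcoactE !tmap_comp; exact: tmap_eq.
Qed.

Lemma counit_subcoact n : rcontr _ (counit C) (subcoact n) = n.
Proof.
apply: subval_inj; rewrite -!inclE -tmap_rcontr subcoactE; exact: counit_coact.
Qed.

Definition sub_comod : comodule C :=
  @Comodule K C (subsp N) subcoact subcoactA counit_subcoact.

Lemma incl_is_chom : @is_chom sub_comod M (incl N).
Proof. by move=> n; rewrite -subcoactE. Qed.

Definition incl_chom : chom sub_comod M := @Chom sub_comod M (incl N) incl_is_chom.

(* The quotient comodule M/N: its coaction is the unique one which makes the
   projection a comodule map. *)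
Lemma quotcoact_exists :
  exists h : {linear quotsp N -> quotsp N ⊗ C},
    forall m, h (qproj N m) = tmap (qproj N) idfun (coact M m).
Proof.
have [|h hE] := @lin_factor K M (quotsp N) _ (qproj N)
    (tmap (qproj N) (idfun : {linear C -> C}) \o coact M).
  move=> m /eqP; rewrite qproj_eq0 => /(@subcomodP M N)/imspP[y /= <-].
  rewrite tmap_comp; pose z : {linear subsp N -> quotsp N} := @GRing.null_fun _ _.
  rewrite (@tmap_eq _ _ _ _ _ _ z _ (idfun \o (idfun : {linear C -> C}))) //.
    move: y; apply: (tens_lin_ext (g := @GRing.null_fun _ _)) => v w /=.
    by rewrite tmapE /z /= linear0l.
  by move=> n; apply/eqP; rewrite /= qproj_eq0; exact: subvalP.
by exists h.
Qed.

Definition quotcoact : {linear quotsp N -> quotsp N ⊗ C} :=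
  sval (cid quotcoact_exists).

Lemma quotcoactE m :
  quotcoact (qproj N m) = tmap (qproj N) idfun (coact M m).
Proof. by rewrite /quotcoact; case: cid. Qed.

Lemma quotcoactA q : tassoc _ _ _ (tmap quotcoact idfun (quotcoact q))
                    = tmap idfun (comul C) (quotcoact q).
Proof.
have [m <-] := qproj_surj q; rewrite quotcoactE.
transitivity (tmap (qproj N) idfun
                (tassoc _ _ _ (tmap (coact M) idfun (coact M m)))).
  transitivity (tmap (qproj N) (tmap idfun idfun)
                (tassoc _ _ _ (tmap (coact M) idfun (coact M m)))).
    rewrite -tassoc_nat !tmap_comp; congr (tassoc _ _ _ _).
    by apply: tmap_eq => // u; exact: quotcoactE.
  by apply: tmap_eq => // u; rewrite tmap_id.
by rewrite coactA !tmap_comp; exact: tmap_eq.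
Qed.

Lemma counit_quotcoact q : rcontr _ (counit C) (quotcoact q) = q.
Proof.
by have [m <-] := qproj_surj q; rewrite quotcoactE tmap_rcontr counit_coact.
Qed.

Definition quot_comod : comodule C :=
  @Comodule K C (quotsp N) quotcoact quotcoactA counit_quotcoact.

Lemma qproj_is_chom : @is_chom M quot_comod (qproj N).
Proof. exact: quotcoactE. Qed.

Definition qproj_chom : chom M quot_comod :=
  @Chom M quot_comod (qproj N) qproj_is_chom.

End SubComodule.

Lemma kersp_is_subcomod M N (f : chom M N) : is_subcomod (kersp f).
Proof.
move=> m /kerspP fm0; apply: tmap_kerl.
by rewrite -chomP fm0 linear0.
Qed.
Definition ker_subcomod M N (f : chom M N) : subcomod M :=
  Subcomod (@kersp_is_subcomod _ _ f).

Lemma imsp_is_subcomod M N (f : chom M N) : is_subcomod (imsp f).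
Proof.
move=> _ /imspP[m <-]; rewrite chomP.
have imf v : f v \in imsp f by apply/imspP; exists v.
have lin : linear (fun v => Subsp (imf v)).
  by move=> a u v; apply: subval_inj; rewrite /= linearP.
apply/imspP; exists (tmap (mklin lin) idfun (coact M m)).
by rewrite tmap_comp; apply: tmap_eq.
Qed.
Definition im_subcomod M N (f : chom M N) : subcomod N :=
  Subcomod (@imsp_is_subcomod _ _ f).

Lemma chom_comp_subproof M N P (g : chom N P) (f : chom M N) :
  @is_chom M P (g \o f).
Proof.
move=> m; rewrite /= !chomP tmap_comp.
by apply: tmap_eq.
Qed.
Definition chom_comp M N P (g : chom N P) (f : chom M N) : chom M P :=
  Chom (chom_comp_subproof g f).

Lemma preimsp_is_subcomod M N (f : chom M N) (P : subcomod N) :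
  is_subcomod (preimsp f P).
Proof.
have kerE m : (m \in kersp (chom_comp (qproj_chom P) f)) = (m \in preimsp f P).
  exact: (qproj_eq0 P (f m)).
move=> m; rewrite -kerE => /(@kersp_is_subcomod _ _ _ m).
by apply: imsp_tmap_inclS => v; rewrite kerE.
Qed.
Definition preim_subcomod M N (f : chom M N) (P : subcomod N) : subcomod M :=
  Subcomod (@preimsp_is_subcomod _ _ f P).

Lemma sumsp_is_subcomod M (F : submodClosed M -> Prop) :
  (forall X, F X -> is_subcomod X) -> is_subcomod (sumsp F).
Proof.
move=> hF _ /sumspP[s [hs ->]]; rewrite linear_sum.
elim: s hs => [|x s IH] hs; first by rewrite big_nil rpred0.
rewrite big_cons; apply: rpredD; last first.
  by apply: IH => y ys; apply: hs; rewrite inE ys orbT.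
have [|N FN xN] := hs x; first by rewrite inE eqxx.
apply: (@imsp_tmap_inclS _ _ N); last exact: hF.
move=> v vN; apply/sumspP; exists [:: v]; rewrite big_seq1; split=> // y.
by rewrite inE => /eqP->; exists N.
Qed.

End Comodules.

Section DirectSum.
Variables (K : fieldType) (C : coalgebra K) (M N : comodule C).

Definition dsum_inl_fun (m : M) : M * N := (m, 0).
Definition dsum_inr_fun (n : N) : M * N := (0, n).
Lemma dsum_inl_linear : linear dsum_inl_fun.
Proof. by move=> a x y; congr pair; rewrite /= scaler0 addr0. Qed.
Lemma dsum_inr_linear : linear dsum_inr_fun.
Proof. by move=> a x y; congr pair; rewrite /= scaler0 addr0. Qed.
Lemma dsum_fst_linear : linear (fst : M * N -> M).
Proof. by []. Qed.
Lemma dsum_snd_linear : linear (snd : M * N -> N).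
Proof. by []. Qed.
Definition dsum_inl_lin := mklin dsum_inl_linear.
Definition dsum_inr_lin := mklin dsum_inr_linear.
Definition dsum_fst_lin := mklin dsum_fst_linear.
Definition dsum_snd_lin := mklin dsum_snd_linear.

Definition dsum_coact : {linear (M * N)%type -> (M * N)%type ⊗ C} :=
  (tmap dsum_inl_lin idfun \o (coact M \o dsum_fst_lin))
  \+ (tmap dsum_inr_lin idfun \o (coact N \o dsum_snd_lin)).

Lemma dsum_coact_inl m : dsum_coact (dsum_inl_lin m) = tmap dsum_inl_lin idfun (coact M m).
Proof. by rewrite /= !linear0 addr0. Qed.
Lemma dsum_coact_inr n : dsum_coact (dsum_inr_lin n) = tmap dsum_inr_lin idfun (coact N n).
Proof. by rewrite /= !linear0 add0r. Qed.

Lemma dsum_ext (X : lmodType K) (f g : {linear (M * N)%type -> X}) :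
  (forall m, f (dsum_inl_lin m) = g (dsum_inl_lin m)) -> (forall n, f (dsum_inr_lin n) = g (dsum_inr_lin n)) ->
  f =1 g.
Proof.
move=> hl hr [m n]; have -> : (m, n) = dsum_inl_lin m + dsum_inr_lin n.
  by congr pair; rewrite /= ?addr0 ?add0r.
by rewrite !linearD hl hr.
Qed.

Lemma tassoc_nat1 (U V W U' : lmodType K) (f : {linear U -> U'}) x :
  tassoc _ _ _ (tmap (tmap f (idfun : {linear V -> V}))
                  (idfun : {linear W -> W}) x)
  = tmap f idfun (tassoc _ _ _ x).
Proof. by rewrite tassoc_nat; apply: tmap_eq => // u; rewrite tmap_id. Qed.

Lemma dsum_coactA x : tassoc _ _ _ (tmap dsum_coact idfun (dsum_coact x))
                      = tmap idfun (comul C) (dsum_coact x).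
Proof.
move: x; apply: (dsum_ext
  (f := tassoc _ _ _ \o (tmap dsum_coact idfun \o dsum_coact))
  (g := tmap idfun (comul C) \o dsum_coact)) => [m|n].
- transitivity (tassoc _ _ _ (tmap dsum_coact idfun (dsum_coact (dsum_inl_lin m)))).
    by [].
  rewrite dsum_coact_inl.
  transitivity (tmap idfun (comul C) (dsum_coact (dsum_inl_lin m))); last by [].
  rewrite dsum_coact_inl tmap_comp.
  transitivity (tmap dsum_inl_lin idfun (tassoc _ _ _ (tmap (coact M) idfun (coact M m)))).
    rewrite -tassoc_nat1 tmap_comp; congr (tassoc _ _ _ _).
    by apply: tmap_eq => // u; exact: dsum_coact_inl.
  by rewrite coactA !tmap_comp; exact: tmap_eq.
- transitivity (tassoc _ _ _ (tmap dsum_coact idfun (dsum_coact (dsum_inr_lin n)))).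
    by [].
  rewrite dsum_coact_inr.
  transitivity (tmap idfun (comul C) (dsum_coact (dsum_inr_lin n))); last by [].
  rewrite dsum_coact_inr tmap_comp.
  transitivity (tmap dsum_inr_lin idfun (tassoc _ _ _ (tmap (coact N) idfun (coact N n)))).
    rewrite -tassoc_nat1 tmap_comp; congr (tassoc _ _ _ _).
    by apply: tmap_eq => // u; exact: dsum_coact_inr.
  by rewrite coactA !tmap_comp; exact: tmap_eq.
Qed.

Lemma counit_dsum_coact x : rcontr _ (counit C) (dsum_coact x) = x.
Proof.
move: x; apply: (dsum_ext (f := rcontr _ (counit C) \o dsum_coact)
  (g := idfun)) => [m|n].
- transitivity (rcontr _ (counit C) (dsum_coact (dsum_inl_lin m))); first by [].
  by rewrite dsum_coact_inl tmap_rcontr counit_coact.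
- transitivity (rcontr _ (counit C) (dsum_coact (dsum_inr_lin n))); first by [].
  by rewrite dsum_coact_inr tmap_rcontr counit_coact.
Qed.

Definition dsum_comod : comodule C :=
  @Comodule K C (M * N)%type dsum_coact dsum_coactA counit_dsum_coact.

Definition dsum_inl : chom M dsum_comod := @Chom K C M dsum_comod dsum_inl_lin dsum_coact_inl.

Lemma dsum_snd_is_chom : @is_chom K C dsum_comod N dsum_snd_lin.
Proof.
apply: (dsum_ext (f := coact N \o dsum_snd_lin)
  (g := tmap dsum_snd_lin idfun \o dsum_coact)) => [m|n].
- transitivity (tmap dsum_snd_lin idfun (dsum_coact (dsum_inl_lin m))); last by [].
  rewrite dsum_coact_inl tmap_comp /= linear0.
  pose z : {linear M -> N} := @GRing.null_fun _ _.
  rewrite (@tmap_eq _ _ _ _ _ _ z _ (idfun \o (idfun : {linear C -> C}))) //.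
  move: (coact M m); apply: (tens_lin_ext (f := @GRing.null_fun _ _)) => v w.
  by rewrite tmapE /= linear0l.
- transitivity (tmap dsum_snd_lin idfun (dsum_coact (dsum_inr_lin n))); last by [].
  rewrite dsum_coact_inr tmap_comp -[LHS]tmap_id; exact: tmap_eq.
Qed.

Definition dsum_snd : chom dsum_comod N := Chom dsum_snd_is_chom.

End DirectSum.

(* Ext^1(A, B) is the set of extensions 0 -> B -> X -> A -> 0 up to Yoneda
   equivalence; its zero is the class of the direct sum of B and A. *)
Section Ext.
Variables (K : fieldType) (C : coalgebra K) (A B : comodule C).

Record extension := Extension {
  ext_mid :> comodule C;
  ext_in : chom B ext_mid;
  ext_out : chom ext_mid A;
  ext_in_inj : injective ext_in;
  ext_out_surj : forall a, exists x, ext_out x = a;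
  ext_exact : forall x, ext_out x = 0 <-> exists b, ext_in b = x }.

Definition ext_equiv (X Y : extension) : Prop :=
  exists h : chom X Y, (forall b, h (ext_in X b) = ext_in Y b) /\
                       (forall x, ext_out Y (h x) = ext_out X x).

Lemma trivial_ext_in_inj : injective (dsum_inl B A).
Proof. by move=> x y []. Qed.
Lemma trivial_ext_out_surj a : exists x, dsum_snd B A x = a.
Proof. by exists (0, a). Qed.
Lemma trivial_ext_exact x :
  dsum_snd B A x = 0 <-> exists b, dsum_inl B A b = x.
Proof. by case: x => b a; split=> [/= ->|[b' [_ <-]]] //; exists b. Qed.

Definition trivial_ext : extension :=
  Extension trivial_ext_in_inj trivial_ext_out_surj trivial_ext_exact.

Definition Ext1_neq0 : Prop := exists X : extension, ~ ext_equiv trivial_ext X.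

End Ext.

Section Structure.
Variables (K : fieldType) (C : coalgebra K).
Implicit Types M N E : comodule C.

Definition simple_comod M : Prop :=
  (exists m : M, m <> 0) /\
  forall N : subcomod M, (forall m, m \in N -> m = 0) \/ (forall m, m \in N).

Definition injective_comod E : Prop :=
  forall M N (i : chom M N) (f : chom M E), injective i ->
    exists g : chom N E, forall m, g (i m) = f m.

Definition essential_mono M E (i : chom M E) : Prop :=
  injective i /\
  forall N : subcomod E, (exists2 x, x \in N & x <> 0) ->
    exists2 m, i m \in N & i m <> 0.

Definition injective_envelope M E : Prop :=
  injective_comod E /\ exists i : chom M E, essential_mono i.

Definition socle_sp M : submodClosed M :=
  sumsp (fun X => exists2 N : subcomod M,
                    subcomod_sp N = X & simple_comod (sub_comod N)).

Lemma socle_is_subcomod M : is_subcomod (socle_sp M).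
Proof. by apply: sumsp_is_subcomod => _ [N <- _]; exact: subcomodP. Qed.

Definition socle M : subcomod M := Subcomod (@socle_is_subcomod M).

Lemma zero_is_subcomod M :
  is_subcomod (sumsp (fun _ : submodClosed M => False)).
Proof. exact: sumsp_is_subcomod. Qed.
Definition zero_subcomod M : subcomod M := Subcomod (@zero_is_subcomod M).

(* loewy M n is Soc^n M, with Soc^0 M = 0 *)
Fixpoint loewy M (n : nat) : subcomod M :=
  match n with
  | 0 => zero_subcomod M
  | 1 => socle M
  | n'.+1 => preim_subcomod (qproj_chom (loewy M n'))
                            (socle (quot_comod (loewy M n')))
  end.

Definition is_direct_sum (V : lmodType K) (J : eqType) (N : J -> submodClosed V)
    (P : submodClosed V) : Prop :=
  (forall v, (v \in P) = (v \in sumsp (fun X => exists j, X = N j))) /\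
  (forall (s : seq J) (v : J -> V), uniq s -> (forall j, v j \in N j) ->
     \sum_(j <- s) v j = 0 -> forall j, j \in s -> v j = 0).

Definition basic_coalgebra : Prop :=
  exists (J : eqType) (N : J -> subcomod (regular_comod C)),
    [/\ forall j, simple_comod (sub_comod (N j)),
        forall i j, comod_iso (sub_comod (N i)) (sub_comod (N j)) -> i = j
      & is_direct_sum (fun j => subcomod_sp (N j)) (socle (regular_comod C))].

Definition complete_simples (I : Type) (S : I -> comodule C) : Prop :=
  [/\ forall x, simple_comod (S x),
      forall x y, comod_iso (S x) (S y) -> x = y
    & forall M, simple_comod M -> exists x, comod_iso M (S x)].

(* The right Ext-quiver, the vertex S x being represented by its index x *)
Definition arrow (I : Type) (S : I -> comodule C) (y x : I) : Prop :=
  Ext1_neq0 (S y) (S x).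

Definition quiver_path (I : Type) (S : I -> comodule C) : I -> I -> Prop :=
  clos_refl_trans I (arrow S).

Definition quiver_connected (I : Type) (S : I -> comodule C) : Prop :=
  forall x y, clos_refl_sym_trans I (arrow S) x y.

Definition n_predecessor (I : Type) (S E : I -> comodule C) (n : nat) (y x : I)
    : Prop :=
  Ext1_neq0 (S y) (sub_comod (loewy (E x) n)).

Definition predecessor (I : Type) (S E : I -> comodule C) (y x : I) : Prop :=
  exists2 n, (1 <= n)%N & n_predecessor S E n y x.

End Structure.

Section Dual.
Variables (K : fieldType) (C : coalgebra K).

(* The convolution product of C^*, (e f)(c) = \sum e(c_1) f(c_2) *)
Definition conv (e f : {scalar C}) : {scalar C} :=
  e \o (rcontr C f \o comul C).

Record idem := Idem {
  idem_fun :> {scalar C};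
  idemP : conv idem_fun idem_fun =1 idem_fun }.

(* e m = \sum m_0 e(m_1) *)
Definition act (e : {scalar C}) (M : comodule C) : {linear M -> M} :=
  rcontr M e \o coact M.

(* e c = \sum c_1 e(c_2) and c e = \sum e(c_1) c_2 *)
Definition lhit (e : {scalar C}) : {linear C -> C} := rcontr C e \o comul C.
Definition rhit (e : {scalar C}) : {linear C -> C} := lcontr C e \o comul C.

Lemma coact_act e M m : coact M (act e M m) = tmap idfun (lhit e) (coact M m).
Proof.
rewrite /act /= -tmap_rcontr -rcontr_assoc coactA tmap_comp.
by apply: tmap_eq.
Qed.

Lemma comul_lhit e c : comul C (lhit e c) = tmap idfun (lhit e) (comul C c).
Proof. exact: (@coact_act e (regular_comod C)). Qed.

Lemma comul_rhit e c : comul C (rhit e c) = tmap (rhit e) idfun (comul C c).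
Proof.
rewrite /rhit /= -tmap_lcontr -comulA lcontr_assoc tmap_comp.
by apply: tmap_eq.
Qed.

Lemma lhit_rhit e f c : lhit e (rhit f c) = rhit f (lhit e c).
Proof. by rewrite {1}/lhit /= comul_rhit tmap_rcontr. Qed.

Lemma tmap_lhit_comul e c :
  tmap (lhit e) idfun (comul C c) = tmap idfun (rhit e) (comul C c).
Proof.
transitivity (tmap (rcontr C e) idfun (tmap (comul C) idfun (comul C c))).
  by rewrite tmap_comp; apply: tmap_eq.
by rewrite -mcontr_assoc comulA tmap_comp; apply: tmap_eq.
Qed.

Lemma convE e f c : conv e f c = f (rhit e c).
Proof. by rewrite /conv /= lrcontr. Qed.

Lemma counit_lhit e c : counit C (lhit e c) = e c.
Proof. by rewrite /lhit /= lrcontr counit_comull. Qed.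

Lemma rcontr_eq (V W : lmodType K) (f g : {scalar W}) x : f =1 g -> rcontr V f x = rcontr V g x.
Proof.
move=> fg; move: x; apply: tens_lin_ext => v w; by rewrite !rcontrE fg.
Qed.

Lemma lcontr_eq (V W : lmodType K) (f g : {scalar V}) x : f =1 g -> lcontr W f x = lcontr W g x.
Proof.
move=> fg; move: x; apply: tens_lin_ext => v w; by rewrite !lcontrE fg.
Qed.

Lemma actK (e : idem) M m : act e M (act e M m) = act e M m.
Proof.
rewrite {1}/act /= coact_act rcontr_tmap; apply: rcontr_eq; exact: idemP.
Qed.

Lemma lhitK (e : idem) c : lhit e (lhit e c) = lhit e c.
Proof. exact: (@actK e (regular_comod C)). Qed.

Lemma rhitK (e : idem) c : rhit e (rhit e c) = rhit e c.
Proof.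
rewrite {1}/rhit /= comul_rhit lcontr_tmap; apply: lcontr_eq => d.
by rewrite -[RHS]idemP convE.
Qed.

Lemma rcontrB (V W : lmodType K) (f g : {scalar W}) x :
  rcontr V (f \- g) x = rcontr V f x - rcontr V g x.
Proof.
move: x; apply: (tens_lin_ext (g := rcontr V f \- rcontr V g)) => v w /=.
by rewrite !rcontrE /= scalerBl.
Qed.

Lemma idem_compl_subproof (e : idem) :
  conv (counit C \- e) (counit C \- e) =1 counit C \- e.
Proof.
move=> c; rewrite /conv /= rcontrB counit_comulr !linearB /= -/(lhit e c).
have -> : e (rcontr C e (comul C c)) = e c by exact: idemP.
have -> : counit C (rcontr C e (comul C c)) = e c by exact: counit_lhit.
by rewrite subrr subr0.
Qed.

(* 1 - e, the unit of C^* being the counit of C *)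
Definition idem_compl (e : idem) : idem := Idem (@idem_compl_subproof e).

End Dual.

Section Corestriction.
Variables (K : fieldType) (V : lmodType K) (p : {linear V -> V}).

Lemma in_imsp v : p v \in imsp p.
Proof. by apply/imspP; exists v. Qed.
Lemma corestr_linear : linear (fun v => Subsp (in_imsp v)).
Proof. by move=> a u v; apply: subval_inj; rewrite /= linearP. Qed.
Definition corestr : {linear V -> subsp (imsp p)} := mklin corestr_linear.

Lemma corestrE v : incl (imsp p) (corestr v) = p v.
Proof. by []. Qed.

Lemma corestr_surj x : exists v, corestr v = x.
Proof. by have /imspP[v vE] := subvalP x; exists v; apply: subval_inj. Qed.

Lemma corestrK (pp : forall v, p (p v) = p v) x : corestr (incl (imsp p) x) = x.
Proof. by have [v <-] := corestr_surj x; apply: subval_inj; exact: pp. Qed.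

Lemma corestr_comp_eq (f : {linear V -> V}) :
  (forall v, p (f v) = p v) -> forall v, corestr (f v) = corestr v.
Proof. by move=> pf v; apply: subval_inj; exact: pf. Qed.

End Corestriction.

Section Localization.
Variables (K : fieldType) (C : coalgebra K) (e : idem C).

Definition bihit : {linear C -> C} := lhit e \o rhit e.

Lemma bihitE c : bihit c = lhit e (rhit e c). Proof. by []. Qed.

Lemma bihit_lhit c : bihit (lhit e c) = bihit c.
Proof. by rewrite !bihitE -lhit_rhit lhitK. Qed.
Lemma bihit_rhit c : bihit (rhit e c) = bihit c.
Proof. by rewrite !bihitE rhitK. Qed.
Lemma bihitK c : bihit (bihit c) = bihit c.
Proof. by rewrite [X in bihit X]bihitE bihit_lhit bihit_rhit. Qed.
Lemma counit_bihit c : counit C (bihit c) = e c.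
Proof. by rewrite bihitE counit_lhit -convE idemP. Qed.

(* The coalgebra eCe, with Delta(e c e) = \sum e c_1 e \ox e c_2 e *)
Definition eCe_sp : submodClosed C := imsp bihit.
Definition Ce_sp : submodClosed C := imsp (rhit e).

Definition to_eCe : {linear C -> subsp eCe_sp} := corestr bihit.

Definition eCe_comul : {linear subsp eCe_sp -> subsp eCe_sp ⊗ subsp eCe_sp} :=
  tmap to_eCe to_eCe \o (comul C \o incl eCe_sp).

Definition eCe_counit : {scalar subsp eCe_sp} := counit C \o incl eCe_sp.

Lemma to_eCe_bihit c : to_eCe (bihit c) = to_eCe c.
Proof. apply: subval_inj; exact: bihitK. Qed.

Lemma eCe_comulE c : eCe_comul (to_eCe c) = tmap to_eCe to_eCe (comul C c).
Proof.
have -> : eCe_comul (to_eCe c) = tmap to_eCe to_eCe (comul C (bihit c)) by [].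
rewrite bihitE comul_lhit comul_rhit !tmap_comp; apply: tmap_eq => u /=.
  by apply: subval_inj; exact: bihit_rhit.
by apply: subval_inj; exact: bihit_lhit.
Qed.

Lemma eCe_comulA x : tassoc _ _ _ (tmap eCe_comul idfun (eCe_comul x))
                     = tmap idfun eCe_comul (eCe_comul x).
Proof.
have [c <-] := corestr_surj x; rewrite -/to_eCe eCe_comulE !tmap_comp.
transitivity (tassoc _ _ _
  (tmap (tmap to_eCe to_eCe) to_eCe (tmap (comul C) idfun (comul C c)))).
  rewrite tmap_comp; congr (tassoc _ _ _ _).
  by apply: tmap_eq => // u; exact: eCe_comulE.
rewrite tassoc_nat comulA tmap_comp; apply: tmap_eq => // u /=.
by rewrite -eCe_comulE.
Qed.

Lemma eCe_counitl x : lcontr _ eCe_counit (eCe_comul x) = x.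
Proof.
have [c <-] := corestr_surj x; rewrite -/to_eCe eCe_comulE.
transitivity (to_eCe (rhit e c)); last by apply: subval_inj; exact: bihit_rhit.
transitivity (lcontr _ eCe_counit
                (tmap to_eCe idfun (tmap idfun to_eCe (comul C c)))).
  by rewrite tmap_comp; congr (lcontr _ _ _); apply: tmap_eq.
rewrite lcontr_tmap tmap_lcontr; congr (to_eCe _).
by apply: lcontr_eq => d; exact: counit_bihit.
Qed.

Lemma eCe_counitr x : rcontr _ eCe_counit (eCe_comul x) = x.
Proof.
have [c <-] := corestr_surj x; rewrite -/to_eCe eCe_comulE.
transitivity (to_eCe (lhit e c)); last by apply: subval_inj; exact: bihit_lhit.
transitivity (rcontr _ eCe_counit
                (tmap idfun to_eCe (tmap to_eCe idfun (comul C c)))).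
  by rewrite tmap_comp; congr (rcontr _ _ _); apply: tmap_eq.
rewrite rcontr_tmap tmap_rcontr; congr (to_eCe _).
by apply: rcontr_eq => d; exact: counit_bihit.
Qed.

Definition eCe : coalgebra K :=
  @Coalgebra K (subsp eCe_sp) eCe_comul eCe_counit
    eCe_comulA eCe_counitl eCe_counitr.

(* The quotient functor T(M) = eM, with coaction
   e m |-> \sum e m_0 \ox e m_1 e *)
Section Quotient.
Variable M : comodule C.

Definition eM_sp : submodClosed M := imsp (act e M).
Definition to_eM : {linear M -> subsp eM_sp} := corestr (act e M).

Definition eM_coact : {linear subsp eM_sp -> subsp eM_sp ⊗ eCe} :=
  tmap to_eM to_eCe \o (coact M \o incl eM_sp).

Lemma eM_coactE m : eM_coact (to_eM m) = tmap to_eM to_eCe (coact M m).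
Proof.
have -> : eM_coact (to_eM m) = tmap to_eM to_eCe (coact M (act e M m)) by [].
rewrite coact_act !tmap_comp; apply: tmap_eq => u //=.
by apply: subval_inj; exact: bihit_lhit.
Qed.

Lemma eM_coactA x : tassoc _ _ _ (tmap eM_coact idfun (eM_coact x))
                    = tmap idfun (comul eCe) (eM_coact x).
Proof.
have [m <-] := corestr_surj x; rewrite -/to_eM eM_coactE !tmap_comp.
transitivity (tassoc _ _ _
  (tmap (tmap to_eM to_eCe) to_eCe (tmap (coact M) idfun (coact M m)))).
  rewrite tmap_comp; congr (tassoc _ _ _ _).
  by apply: tmap_eq => // u; exact: eM_coactE.
rewrite tassoc_nat coactA tmap_comp; apply: tmap_eq => // u /=.
by rewrite -eCe_comulE.
Qed.

Lemma counit_eM_coact x : rcontr _ (counit eCe) (eM_coact x) = x.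
Proof.
have [m <-] := corestr_surj x; rewrite -/to_eM eM_coactE.
transitivity (to_eM (act e M m)); last by apply: subval_inj; exact: actK.
transitivity (rcontr _ (counit eCe)
                (tmap idfun to_eCe (tmap to_eM idfun (coact M m)))).
  by rewrite tmap_comp; congr (rcontr _ _ _); apply: tmap_eq.
rewrite rcontr_tmap tmap_rcontr; congr (to_eM _).
by apply: rcontr_eq => d; exact: counit_bihit.
Qed.

Definition quotient_functor : comodule eCe :=
  @Comodule K eCe (subsp eM_sp) eM_coact eM_coactA counit_eM_coact.

End Quotient.
End Localization.

Section TensComod.
Variables (K : fieldType) (C : coalgebra K) (V : lmodType K) (M : comodule C).

(* V ⊗ M with coaction V ⊗ coact M *)
Definition tens_coact : {linear V ⊗ M -> (V ⊗ M) ⊗ C} :=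
  tassocV V M C \o tmap idfun (coact M).

Lemma tassoc_tens_coact x :
  tassoc V M C (tens_coact x) = tmap idfun (coact M) x.
Proof. by rewrite /tens_coact /= tassocVK. Qed.

Lemma tassoc_pentagon (U W X Y : lmodType K) (x : ((U ⊗ W) ⊗ X) ⊗ Y) :
  tmap idfun (tassoc W X Y) (tassoc U (W ⊗ X) Y (tmap (tassoc U W X) idfun x))
  = tassoc U W (X ⊗ Y) (tassoc (U ⊗ W) X Y x).
Proof.
move: x; apply: (tens3_ext
  (f := tmap idfun (tassoc W X Y) \o (tassoc U (W ⊗ X) Y
          \o tmap (tassoc U W X) idfun))
  (g := tassoc U W (X ⊗ Y) \o tassoc (U ⊗ W) X Y)) => z v w.
pose f := tmap idfun (tassoc W X Y) \o (tassoc U (W ⊗ X) Y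
          \o tmap (tassoc U W X) idfun).
pose g := tassoc U W (X ⊗ Y) \o tassoc (U ⊗ W) X Y.
have h : f \o (applyr (@tens K _ _) w \o applyr (@tens K _ _) v)
       =1 g \o (applyr (@tens K _ _) w \o applyr (@tens K _ _) v).
  apply: tens_lin_ext => a b.
  by rewrite /f /g /= !(tmapE, tassocE).
exact: (h z).
Qed.

Lemma tens_coactA x : tassoc _ _ _ (tmap tens_coact idfun (tens_coact x))
                      = tmap idfun (comul C) (tens_coact x).
Proof.
apply: (can_inj (@tassocK _ _ _ _)).
rewrite -tassoc_pentagon.
transitivity (tmap idfun (tassoc M C C) (tassoc V (M ⊗ C) C
   (tmap (tmap idfun (coact M)) idfun (tens_coact x)))).
  congr (tmap idfun _ (tassoc _ _ _ _)); rewrite tmap_comp.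
  by apply: tmap_eq => // u; exact: tassoc_tens_coact.
rewrite tassoc_nat tassoc_tens_coact !tmap_comp.
transitivity (tmap idfun (tmap idfun (comul C)) (tassoc _ _ _ (tens_coact x))).
  rewrite tassoc_tens_coact tmap_comp; apply: tmap_eq => // u /=.
  by rewrite -coactA.
rewrite -tassoc_nat; congr (tassoc _ _ _ _); apply: tmap_eq => // u.
by rewrite tmap_id.
Qed.

Lemma counit_tens_coact x : rcontr _ (counit C) (tens_coact x) = x.
Proof.
rewrite -rcontr_assoc tassoc_tens_coact tmap_comp -[RHS]tmap_id.
by apply: tmap_eq => // u; exact: counit_coact.
Qed.

Definition tens_comod : comodule C :=
  @Comodule K C (V ⊗ M) tens_coact tens_coactA counit_tens_coact.

End TensComod.

Section TensComodMaps.
Variables (K : fieldType) (C : coalgebra K).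

Lemma tens_is_chom (V : lmodType K) (M : comodule C) (N : comodule C)
    (f : {linear N -> V ⊗ M}) :
  (forall n, tmap idfun (coact M) (f n) =
             tassoc _ _ _ (tmap f idfun (coact N n))) ->
  @is_chom K C N (tens_comod V M) f.
Proof.
move=> h n; apply: (can_inj (@tassocK _ _ _ _)).
by rewrite tassoc_tens_coact h.
Qed.

Lemma tmap_idl_is_chom (V : lmodType K) (M N : comodule C) (f : chom M N) :
  @is_chom K C (tens_comod V M) (tens_comod V N) (tmap idfun f).
Proof.
apply: tens_is_chom => x.
rewrite tassoc_nat tassoc_tens_coact !tmap_comp.
by apply: tmap_eq => // u; exact: chomP.
Qed.

Lemma tmap_idr_is_chom (V W : lmodType K) (M : comodule C)
    (f : {linear V -> W}) :
  @is_chom K C (tens_comod V M) (tens_comod W M) (tmap f idfun).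
Proof.
apply: tens_is_chom => x.
rewrite tassoc_nat tassoc_tens_coact !tmap_comp.
by apply: tmap_eq => // u; rewrite /= tmap_id.
Qed.

Lemma tassoc_is_chom (V W : lmodType K) (M : comodule C) :
  @is_chom K C (tens_comod (V ⊗ W) M) (tens_comod V (tens_comod W M))
    (tassoc V W M).
Proof.
apply: tens_is_chom => x.
have tE y : coact (tens_comod W M) y = tassocV _ _ _ (tmap idfun (coact M) y).
  by [].
transitivity (tmap idfun (tassocV W M C) (tmap idfun (tmap idfun (coact M))
    (tassoc V W M x))).
  by rewrite tmap_comp; apply: tmap_eq.
rewrite -tassoc_nat.
have -> : tmap (tmap idfun idfun) (coact M) x =
          tassoc _ _ _ (coact (tens_comod (V ⊗ W) M) x).
  rewrite tassoc_tens_coact; apply: tmap_eq => // u; exact: tmap_id.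
rewrite -tassoc_pentagon tmap_comp -[RHS]tmap_id; apply: tmap_eq => // u.
exact: tassocK.
Qed.

Lemma sub_is_chom (M N : comodule C) (f g : {linear M -> N}) :
  is_chom f -> is_chom g -> is_chom (f \- g).
Proof.
move=> hf hg m; rewrite /= linearB hf hg.
move: (coact M m); apply: (tens_lin_ext
  (f := tmap f idfun \- tmap g idfun)) => v w.
by rewrite /= !tmapE /= linearBl.
Qed.

End TensComodMaps.

(* The section functor S(N), the cotensor product of N and Ce over eCe, a
   subcomodule of N ⊗ Ce with the coaction coming from Ce *)
Section SectionFunctor.
Variables (K : fieldType) (C : coalgebra K) (e : idem C).

Lemma rhit_is_chom :
  @is_chom K C (regular_comod C) (regular_comod C) (rhit e).
Proof. exact: comul_rhit. Qed.

Definition rhit_chom : chom (regular_comod C) (regular_comod C) :=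
  Chom rhit_is_chom.

Definition Ce : comodule C := sub_comod (im_subcomod rhit_chom).

Definition to_Ce : {linear C -> Ce} := corestr (rhit e).

(* The left eCe-coaction c e |-> \sum e c_1 e \ox c_2 e of Ce *)
Definition Ce_lcoact : {linear Ce -> eCe e ⊗ Ce} :=
  tmap (to_eCe e) to_Ce \o (comul C \o incl (Ce_sp e)).

Lemma coact_to_Ce c : coact Ce (to_Ce c) = tmap to_Ce idfun (comul C c).
Proof.
apply: (@tmap_injl _ _ _ C (incl (Ce_sp e)) (@subval_inj _ _ _)).
transitivity (comul C (rhit e c)); first exact:
    (@subcoactE _ _ _ (im_subcomod rhit_chom) (to_Ce c)).
by rewrite comul_rhit tmap_comp; apply: tmap_eq.
Qed.

Lemma Ce_lcoact_is_chom :
  @is_chom K C Ce (tens_comod (eCe e) Ce) Ce_lcoact.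
Proof.
apply: tens_is_chom => x.
transitivity (tmap (to_eCe e) (tmap to_Ce idfun)
   (tmap idfun (comul C) (comul C (incl (Ce_sp e) x)))).
  rewrite /Ce_lcoact !tmap_comp; apply: tmap_eq => // u.
  exact: coact_to_Ce.
rewrite -comulA -tassoc_nat; congr (tassoc _ _ _ _).
rewrite -(@subcoactE _ _ _ (im_subcomod rhit_chom)) !tmap_comp.
by apply: tmap_eq.
Qed.

Section Cotensor.
Variable N : comodule (eCe e).

(* The cotensor product is the kernel of the difference of coact N ⊗ Ce and
   N ⊗ Ce_lcoact, both with values in N ⊗ (eCe ⊗ Ce). *)
Definition cotens_map : {linear N ⊗ Ce -> N ⊗ (eCe e ⊗ Ce)} :=
  (tassoc N (eCe e) Ce \o tmap (coact N) idfun) \- tmap idfun Ce_lcoact.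

Lemma cotens_map_is_chom :
  @is_chom K C (tens_comod N Ce) (tens_comod N (tens_comod (eCe e) Ce))
    cotens_map.
Proof.
have h1 := @tmap_idl_is_chom K C N Ce (tens_comod (eCe e) Ce)
  (Chom Ce_lcoact_is_chom).
have h2 := @chom_comp_subproof _ _ (tens_comod N Ce)
  (tens_comod (N ⊗ eCe e) Ce) (tens_comod N (tens_comod (eCe e) Ce))
  (Chom (@tassoc_is_chom K C N (eCe e) Ce))
  (Chom (@tmap_idr_is_chom K C _ _ Ce (coact N))).
exact: (sub_is_chom h2 h1).
Qed.

Definition section_functor : comodule C :=
  sub_comod (ker_subcomod (Chom cotens_map_is_chom)).

End Cotensor.
End SectionFunctor.

Section Torsion.
Variables (K : fieldType) (C : coalgebra K).

(* The objects of T_e: those M with T(M) = 0 *)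
Definition torsion (e : idem C) (M : comodule C) : Prop :=
  forall m : quotient_functor e M, m = 0.

Definition stable_class (T : comodule C -> Prop) : Prop :=
  forall M E, T M -> injective_envelope M E -> T E.

(* The subspace N is the largest e-torsion subcomodule of M. *)
Definition is_torsion_subcomod (e : idem C) (M : comodule C)
    (N : submodClosed M) : Prop :=
  exists hN : is_subcomod N, torsion e (sub_comod (Subcomod hN)) /\
    forall P : subcomod M, torsion e (sub_comod P) ->
      forall m, m \in P -> m \in N.

(* Ce = eCe *)
Definition right_semicentral (e : idem C) : Prop :=
  forall c, (c \in Ce_sp e) = (c \in eCe_sp e).

(* T(M) = M, that is, eM = M *)
Definition T_full (e : idem C) (M : comodule C) : Prop :=
  forall m : M, m \in eM_sp e M.

(* x \in I_e, that is, T(S_x) <> 0 *)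
Definition torsion_free_vertex (I : Type) (S : I -> comodule C) (e : idem C)
    (x : I) : Prop :=
  ~ torsion e (S x).

End Torsion.

(* Main.v *)
Require Import Defs.
From HB Require Import structures.
From mathcomp Require Import all_boot all_order all_algebra.
From mathcomp Require Import boolp.
From Stdlib Require Import Relation_Operators.

Set Implicit Arguments.
Unset Strict Implicit.
Unset Printing Implicit Defensive.

Import GRing.Theory.
Local Open Scope ring_scope.

(** Write f = 1 - e. Functionals on C separate tensors, so subcomodules are the
    subspaces stable under the action of C^*, and comodule maps are the linear
    maps commuting with it. Since C is basic, all copies of a simple comodule T
    in C coincide, whence e acts on T as 0 or as the identity.

    Everything goes through the condition that e C^* f kills every comodule.
    On C it says that f C e = 0, which is (g); on M it says that f M is a
    subcomodule, which is (h). It implies (a), because in an essential extension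
    E of a comodule fixed by e, the subcomodule f E meets that comodule in 0.
    Conversely (f) implies it: by local finiteness it is enough to treat M of
    finite dimension, by induction, and a minimal obstruction would be a
    non-split extension of a simple comodule killed by e by a simple comodule
    fixed by e. For (i), the unit M -> S(T(M)) is bijective when Ce = eCe and e
    fixes M, and for an extension X of S_y by S_x with e S_y = 0 and e S_x = S_x
    the unit X -> S(T(X)) = S(T(S_x)) = S_x is a retraction. *)

(** * Linear algebra *)

Section Linear.
Variable K : fieldType.
Implicit Types U V W : lmodType K.

Lemma line_linear V (v : V) : linear (fun a : K^o => a *: v).
Proof. by move=> a x y; rewrite scalerDl scalerA. Qed.

Lemma exists_scalar V (v : V) : v <> 0 -> exists phi : {scalar V}, phi v <> 0.
Proof.
move=> v0; have [|s sE] := @lin_factor K _ V K^o (mklin (line_linear v)) idfun.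
  by move=> a /= /eqP; rewrite scaler_eq0 => /orP[/eqP|/eqP].
exists s; have := sE 1; rewrite /= scale1r => ->; exact/eqP/oner_neq0.
Qed.

Lemma left_inverse_lin V W (f : {linear V -> W}) : injective f ->
  exists r : {linear W -> V}, forall v, r (f v) = v.
Proof.
move=> fi; apply: (@lin_factor K V W V f idfun) => a fa0.
by apply: fi; rewrite fa0 linear0.
Qed.

Lemma inj_lin V W (f : {linear V -> W}) :
  (forall v, f v = 0 -> v = 0) -> injective f.
Proof.
move=> h x y fxy; apply/eqP; rewrite -subr_eq0; apply/eqP/h.
by rewrite linearB fxy subrr.
Qed.

Lemma bij_lin V W (f : {linear V -> W}) :
  injective f -> (forall w, exists v, f v = w) -> bijective f.
Proof.
move=> /left_inverse_lin[r rK] fs; exists r => // w.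
by have [v <-] := fs w; rewrite rK.
Qed.

(** Induction on the number of terms: killing the first vector [v] shortens the sum, so [x] dies in
    V/Kv ⊗ W and is a pure tensor [v \ox w], which one functional detects. *)
Lemma tens_sep V W (x : V ⊗ W) :
  (forall phi : {scalar W}, rcontr V phi x = 0) -> x = 0.
Proof.
rewrite (tens_expand x); move: (repr x) => {x} s.
have [n] := ubnP (size s); elim: n V s => // n IH V [|[v w0] s].
  by rewrite big_nil.
move=> sn; set x := \sum_(p <- _) _ => hx.
pose L := imsp (mklin (line_linear v)).
have qv : qproj L v = 0.
  by apply/eqP; rewrite qproj_eq0; apply/imspP; exists 1; exact: scale1r.
have qE : tmap (qproj L) (idfun : {linear W -> W}) x =
    \sum_(p <- [seq (qproj L p.1, p.2) | p <- s]) p.1 \ox p.2.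
  rewrite /x big_cons linearD /= tmapE qv linear0l add0r big_map linear_sum.
  by apply: eq_bigr => p _; exact: tmapE.
have qx : tmap (qproj L) (idfun : {linear W -> W}) x = 0.
  rewrite qE; apply: IH; first by rewrite size_map.
  by move=> phi; rewrite -qE tmap_rcontr hx linear0.
have /imspP[y yx] := tmap_kerl qx.
have kerL u : u \in kersp (qproj L) -> exists a : K, u = a *: v.
  by move=> /kerspP/eqP; rewrite qproj_eq0 => /imspP[a <-]; exists a.
have [w xE] : exists w, x = v \ox w.
  rewrite -yx (tens_expand y); elim: (repr y) => [|[u w] t [w' E]].
    by exists 0; rewrite big_nil !linear0 ?linear0r.
  rewrite big_cons linearD E /= tmapE /=.
  have [a ->] := kerL _ (subvalP u).
  by exists (a *: w + w'); rewrite linearPr linearZl_LR.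
have [v0|v0] := EM (v = 0); first by rewrite xE v0 linear0l.
rewrite xE; have [->|w_neq0] := EM (w = 0); first by rewrite linear0r.
have [phi phiw] := exists_scalar w_neq0.
have := hx phi; rewrite xE rcontrE => /eqP.
by rewrite scaler_eq0 => /orP[/eqP|/eqP].
Qed.

End Linear.

(** * Comodules as modules over the dual algebra *)

Section DualAction.
Variables (K : fieldType) (C : coalgebra K).
Implicit Types (M N P : comodule C) (phi psi : {scalar C}).

Lemma chom_act M N (f : chom M N) phi m : f (act phi M m) = act phi N (f m).
Proof. by rewrite /act /= -tmap_rcontr chomP. Qed.

(** By [tens_sep] an element of N ⊗ C is determined by its contractions, and those of a coaction are
    the actions of functionals. *)
Lemma act_is_chom M N (f : {linear M -> N}) :
  (forall phi m, f (act phi M m) = act phi N (f m)) -> is_chom f.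
Proof.
move=> h m; apply/eqP; rewrite -subr_eq0; apply/eqP; apply: tens_sep => phi.
rewrite linearB tmap_rcontr; apply/eqP; rewrite subr_eq0; apply/eqP.
exact: esym (h phi m).
Qed.

Lemma subcomod_act M (N : submodClosed M) : is_subcomod N ->
  forall phi m, m \in N -> act phi M m \in N.
Proof.
move=> hN phi m mN; rewrite /act /=.
have /imspP[x <-] := hN m mN.
by rewrite tmap_rcontr inclE; exact: subvalP.
Qed.

(** All contractions of [coact M m] vanish modulo [N], so it lies in the kernel of M ⊗ C -> M/N ⊗ C,
    which is N ⊗ C. *)
Lemma act_is_subcomod M (N : submodClosed M) :
  (forall phi m, m \in N -> act phi M m \in N) -> is_subcomod N.
Proof.
move=> h m mN.
have qx : tmap (qproj N) (idfun : {linear C -> C}) (coact M m) = 0.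
  apply: tens_sep => phi; rewrite tmap_rcontr.
  by apply/eqP; rewrite qproj_eq0; exact: h.
apply: imsp_tmap_inclS (tmap_kerl qx) => v.
by move=> /kerspP/eqP; rewrite qproj_eq0.
Qed.

Lemma act_counit M m : act (counit C) M m = m.
Proof. exact: counit_coact. Qed.

Lemma act_conv M phi psi m :
  act phi M (act psi M m) = act (conv phi psi) M m.
Proof. by rewrite {1}/act /= coact_act rcontr_tmap; exact: rcontr_eq. Qed.

Lemma actD M phi psi m : act (phi \+ psi) M m = act phi M m + act psi M m.
Proof.
rewrite /act /=; move: (coact M m).
apply: (tens_lin_ext (g := rcontr M phi \+ rcontr M psi)) => v w.
by rewrite /= !rcontrE scalerDl.
Qed.

Lemma actN M phi psi m : act (phi \- psi) M m = act phi M m - act psi M m.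
Proof. exact: rcontrB. Qed.

Lemma actZ (a : K) phi :
  exists psi, forall M m, act psi M m = a *: act phi M m.
Proof.
exists (a \*: (phi : {linear C -> K^o}) : {linear C -> K^o}) => M m.
rewrite /act /=; move: (coact M m).
apply: (tens_lin_ext (g := a \*: rcontr M phi)) => v w.
by rewrite rcontrE /= rcontrE scalerA.
Qed.

End DualAction.

(** * Morphisms, simple comodules and cyclic comodules *)

Section Morphisms.
Variables (K : fieldType) (C : coalgebra K).
Implicit Types M N P : comodule C.

(** The linear left inverse [r] of [f] need not be colinear, but [r \o g] is, because [f] is
    injective and f r g = g. *)
Lemma chom_lift M N P (f : chom M N) (g : chom P N) : injective f ->
  (forall p, exists m, f m = g p) -> exists h : chom P M, forall p, f (h p) = g p.
Proof.
move=> fi gf; have [r rK] := left_inverse_lin fi.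
have frg p : f (r (g p)) = g p by have [m <-] := gf p; rewrite rK.
have hc : is_chom (r \o g).
  by apply: act_is_chom => phi p; apply: fi; rewrite /= frg !chom_act frg.
by exists (Chom hc).
Qed.

Lemma chom_factor M N P (f : chom M N) (g : chom M P) :
  (forall n, exists m, f m = n) -> (forall m, f m = 0 -> g m = 0) ->
  exists h : chom N P, forall m, h (f m) = g m.
Proof.
move=> fs kfg; have [h hE] := lin_factor kfg.
have hc : is_chom h.
  apply: act_is_chom => phi n; have [m <-] := fs n.
  by rewrite -chom_act !hE chom_act.
by exists (Chom hc).
Qed.

Lemma chom_id_subproof M : @is_chom K C M M (idfun : {linear M -> M}).
Proof. exact: act_is_chom. Qed.
Definition chom_id M : chom M M := Chom (@chom_id_subproof M).

Lemma chom_inv M N (f : chom M N) : injective f ->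
  (forall n, exists m, f m = n) ->
  exists g : chom N M, cancel f g /\ cancel g f.
Proof.
move=> fi fs; have [|g gK] := @chom_lift _ _ _ f (chom_id N) fi; first exact: fs.
by exists g; split=> // m; apply: fi; rewrite gK.
Qed.

Lemma comod_isoP M N : comod_iso M N <-> exists (f : chom M N) (g : chom N M),
  cancel f g /\ cancel g f.
Proof.
split=> [[f fb]|[f [g [fK gK]]]]; last by exists f, g.
have [g' fK gK] := fb.
have [|g [hf hg]] := chom_inv (bij_inj fb); last by exists f, g.
by move=> n; exists (g' n).
Qed.

Lemma comod_iso_sym M N : comod_iso M N -> comod_iso N M.
Proof. by move=> /comod_isoP[f [g [fK gK]]]; exists g, f. Qed.

Lemma comod_iso_trans M N P : comod_iso M N -> comod_iso N P -> comod_iso M P.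
Proof.
by move=> [f fb] [g gb]; exists (chom_comp g f); exact: bij_comp.
Qed.

Definition nonzero M := exists m : M, m <> 0.

Lemma simple_inj M N (f : chom M N) : simple_comod M ->
  (exists m, f m <> 0) -> injective f.
Proof.
move=> [_ /(_ (ker_subcomod f))[h _|h [m []]]].
  by apply: inj_lin => v fv0; apply: h; exact/kerspP.
exact/kerspP.
Qed.

Lemma simple_surj M N (f : chom M N) : simple_comod N ->
  (exists m, f m <> 0) -> forall n, exists m, f m = n.
Proof.
move=> [_ /(_ (im_subcomod f))[h [m []]|h _ n]].
  by apply: h; apply/imspP; exists m.
exact/imspP.
Qed.

Lemma schur M N (f : chom M N) : simple_comod M -> simple_comod N ->
  (exists m, f m <> 0) -> comod_iso M N.
Proof.
move=> sM sN f0; exists f; apply: bij_lin; first exact: simple_inj.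
exact: simple_surj.
Qed.

Lemma simple_iso M N : comod_iso M N -> simple_comod M -> simple_comod N.
Proof.
move=> /comod_isoP[f [g [fK gK]]] [[m m0] hM]; split.
  by exists (f m) => fm0; apply: m0; rewrite -[m]fK fm0 linear0.
move=> P; have [h|h] := hM (preim_subcomod f P).
  left=> n nP; rewrite -[n]gK (h (g n)) ?linear0 //.
  by rewrite in_preimsp gK.
by right=> n; rewrite -[n]gK -in_preimsp; exact: h.
Qed.

Lemma sub_act M (N : subcomod M) phi (n : sub_comod N) :
  subval (act phi (sub_comod N) n) = act phi M (subval n).
Proof. exact: (chom_act (incl_chom N)). Qed.

Lemma im_iso M N (f : chom M N) : injective f ->
  comod_iso M (sub_comod (im_subcomod f)).
Proof.
move=> fi.
have [|h hE] := @chom_lift _ _ _ (incl_chom (im_subcomod f)) f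
  (@subval_inj _ _ _).
  move=> p; have pf : f p \in im_subcomod f by apply/imspP; exists p.
  by exists (Subsp pf).
exists h; apply: bij_lin => [x y hxy|w]; first by apply: fi; rewrite -!hE hxy.
have /imspP[v fv] := subvalP w; exists v; apply: subval_inj.
by rewrite -fv -hE.
Qed.

Section Orbit.
Variables (M : comodule C) (m : M).

Definition dual_orbit_pred : {pred M} := fun v => `[< exists phi, act phi M m = v >].
Lemma dual_orbit_closed : subsemimod_closed dual_orbit_pred.
Proof.
split; first split.
- by apply/asboolP; exists (counit C \- counit C); rewrite actN subrr.
- move=> _ _ /asboolP[x <-] /asboolP[y <-]; apply/asboolP.
  by exists (x \+ y); rewrite actD.
- move=> a _ /asboolP[x <-]; apply/asboolP.
  by have [y yE] := actZ a x; exists y.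
Qed.
HB.instance Definition _ :=
  GRing.isSubmodClosed.Build K M dual_orbit_pred dual_orbit_closed.
Definition dual_orbit : submodClosed M := dual_orbit_pred.

Lemma dual_orbitP v : reflect (exists phi, act phi M m = v) (v \in dual_orbit).
Proof. exact: asboolP. Qed.

Lemma dual_orbit_is_subcomod : is_subcomod dual_orbit.
Proof.
apply: act_is_subcomod => phi _ /dual_orbitP[psi <-]; apply/dual_orbitP.
by exists (conv phi psi); rewrite act_conv.
Qed.
Definition dual_orbit_subcomod : subcomod M := Subcomod dual_orbit_is_subcomod.

Lemma dual_orbit_id : m \in dual_orbit.
Proof. by apply/dual_orbitP; exists (counit C); exact: act_counit. Qed.

End Orbit.

Lemma simple_cyclic M (m : M) : simple_comod M -> m <> 0 ->
  forall v, exists phi, act phi M m = v.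
Proof.
move=> [_ /(_ (dual_orbit_subcomod m))[h|h] m0 v]; last exact/dual_orbitP.
by case: m0; apply: h; exact: dual_orbit_id.
Qed.

(** [M] is C^* modulo the annihilator of [m], and this annihilator kills [n]. *)
Lemma cyclic_factor M N (m : M) (n : N) :
  (forall v, exists phi, act phi M m = v) ->
  (forall phi, act phi M m = 0 -> act phi N n = 0) ->
  exists h : chom M N, h m = n.
Proof.
move=> gen ker; pose p v := sval (cid (gen v)).
have pE v : act (p v) M m = v by rewrite /p; case: cid.
have wd phi psi : act phi M m = act psi M m -> act phi N n = act psi N n.
  move=> E; apply/eqP; rewrite -subr_eq0 -actN; apply/eqP/ker.
  by rewrite actN E subrr.
have lin : linear (fun v => act (p v) N n).
  move=> a x y; have [q qE] := actZ a (p x).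
  by rewrite -qE -actD; apply: wd; rewrite actD qE !pE.
have hc : is_chom (mklin lin).
  apply: act_is_chom => phi v; rewrite [RHS]act_conv; apply: wd.
  by rewrite -act_conv !pE.
exists (Chom hc); rewrite -[RHS]act_counit; apply: wd.
by rewrite pE act_counit.
Qed.

End Morphisms.

(** * Local finiteness *)

Section FiniteDimension.
Variable K : fieldType.
Implicit Types V U : lmodType K.

Definition spanned_by n V :=
  exists g : {linear 'rV[K]_n -> V}, forall v, exists a, g a = v.

Lemma insert0_linear n (i : 'I_n.+1) :
  linear (fun b : 'rV[K]_n => \row_j oapp (b ord0) 0 (unlift i j)).
Proof.
move=> a x y; apply/rowP => j; rewrite !mxE.
by case: unliftP => [k _|_] /=; rewrite ?mxE // mulr0 addr0.
Qed.

(** A preimage of [v] in K^n has a nonzero coordinate [i]; subtracting multiples of it clears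
    coordinate [i] without changing the image in [U]. *)
Lemma spanned_by_proper n V U (h : {linear V -> U}) v :
  spanned_by n V -> (forall u, exists v, h v = u) -> h v = 0 -> v <> 0 ->
  exists2 k, (k < n)%N & spanned_by k U.
Proof.
move=> [g gs] hs hv0 v0; have [a av] := gs v.
have [i ai] : exists i, a ord0 i != 0.
  apply: contrapT => /forallNP ai; apply: v0; rewrite -av (_ : a = 0) ?linear0 //.
  by apply/rowP => i; rewrite mxE; apply/eqP; exact: contra_notT (ai i).
case: n g gs a av i ai => [|n] g gs a av i ai; first by case: i ai.
exists n => //; exists (h \o (g \o mklin (insert0_linear i))) => u.
have [w <-] := hs u; have [c <-] := gs w.
pose c' := c - (c ord0 i / a ord0 i) *: a.
exists (\row_k c' ord0 (lift i k)) => /=.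
rewrite (_ : \row_j _ = c').
  by rewrite /c' linearB linearZ /= av linearB linearZ /= hv0 scaler0 subr0.
apply/rowP => j; rewrite mxE; case: unliftP => [k ->|->] /=; rewrite mxE //.
by rewrite !mxE divfK // subrr.
Qed.

End FiniteDimension.

Section FiniteComodules.
Variables (K : fieldType) (C : coalgebra K).
Implicit Types M N : comodule C.

(** The left factors in an expression of [coact M m] span a space containing the orbit; they may lie
    outside it, hence the retraction [r]. *)
Lemma dual_orbit_spanned M (m : M) :
  exists n, spanned_by n (sub_comod (dual_orbit_subcomod m)).
Proof.
set s := repr (coact M m); exists (size s).
have lin : linear (fun a : 'rV[K]_(size s) =>
    \sum_i a ord0 i *: (nth (0, 0) s i).1).
  move=> c a b; rewrite scaler_sumr -big_split; apply: eq_bigr => i _ /=.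
  by rewrite !mxE scalerDl scalerA.
have [r rK] := left_inverse_lin (@subval_inj _ _ (dual_orbit m)
  : injective (incl (dual_orbit m))).
exists (r \o mklin lin) => v; have /dual_orbitP[phi phiv] := subvalP v.
exists (\row_i phi (nth (0, 0) s i).2) => /=.
rewrite -[RHS]rK; congr (r _); rewrite /= -phiv /act /=.
rewrite [in RHS](tens_expand (coact M m)) linear_sum /= (big_nth (0, 0)).
rewrite big_mkord; apply: eq_bigr => i _.
by rewrite mxE [RHS]rcontrE.
Qed.

Lemma spanned_has_simple n M : spanned_by n M -> nonzero M ->
  exists T (t : chom T M), simple_comod T /\ injective t.
Proof.
elim/ltn_ind: n M => n IH M Mn M0.
have [sM|] := EM (simple_comod M); first by exists M, (chom_id M); split.
move=> /not_andP[//|/existsNP[N /not_orP[/existsNP[x]]]].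
move=> /not_implyP[xN x0] /existsNP[y yN].
(* A linear retraction presents [N] as a quotient space of [M]; it kills y - r y, which is nonzero
   since [y] is not in [N]. *)
have [r rK] := left_inverse_lin (@subval_inj _ _ N : injective (incl N)).
have [|||k kn Nk] := @spanned_by_proper _ _ _ _ r (y - incl N (r y)) Mn.
- by move=> u; exists (incl N u); exact: rK.
- by rewrite linearB rK subrr.
- by move=> /eqP; rewrite subr_eq0 => /eqP yE; apply: yN; rewrite yE; exact: subvalP.
have [|T [t [sT ti]]] := IH k kn (sub_comod N) Nk.
  by exists (Subsp xN) => /(congr1 (@subval _ _ _)).
by exists T, (chom_comp (incl_chom N) t); split=> // u v /subval_inj/ti.
Qed.

Lemma has_simple M : nonzero M ->
  exists T (t : chom T M), simple_comod T /\ injective t.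
Proof.
move=> [m m0]; have [n hn] := dual_orbit_spanned m.
have [|T [t [sT ti]]] := spanned_has_simple hn.
  by exists (Subsp (dual_orbit_id m)) => /(congr1 (@subval _ _ _)).
exists T, (chom_comp (incl_chom (dual_orbit_subcomod m)) t).
by split=> // u v /subval_inj/ti.
Qed.

End FiniteComodules.

(** * The actions of an idempotent and of its complement *)

Section Idempotent.
Variables (K : fieldType) (C : coalgebra K) (e : idem C).
Implicit Types M N T : comodule C.

Lemma act_compl M m : act (idem_compl e) M m = m - act e M m.
Proof. by rewrite [LHS]actN act_counit. Qed.

Lemma act_e_compl M m : act e M (act (idem_compl e) M m) = 0.
Proof. by rewrite act_compl linearB actK subrr. Qed.

Lemma torsionP M : torsion e M <-> forall m, act e M m = 0.
Proof.
split=> [h m|h m].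
  exact: (congr1 (@subval _ _ _) (h (to_eM e M m))).
by have /imspP[v ev] := subvalP m; apply: subval_inj; rewrite -ev h.
Qed.

Lemma T_fullP M : T_full e M <-> forall m, act e M m = m.
Proof.
split=> [h m|h m]; first by have /imspP[v <-] := h m; rewrite actK.
by apply/imspP; exists m.
Qed.

End Idempotent.

Lemma torsion_complP (K : fieldType) (C : coalgebra K) (e : idem C)
    (M : comodule C) :
  torsion (idem_compl e) M <-> forall m, act e M m = m.
Proof.
split=> [/torsionP h m|h]; last by apply/torsionP => m; rewrite act_compl h subrr.
by have /eqP := h m; rewrite act_compl subr_eq0 => /eqP.
Qed.

Lemma act_iso (K : fieldType) (C : coalgebra K) (phi : {scalar C})
    (M N : comodule C) :
  comod_iso M N -> (forall m, act phi M m = 0) -> forall n, act phi N n = 0.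
Proof.
move=> /comod_isoP[f [g [fK gK]]] h n.
by rewrite -[n]gK -chom_act h linear0.
Qed.

(** * Idempotents and simple comodules over a basic coalgebra *)

Section Basic.
Variables (K : fieldType) (C : coalgebra K) (Cbasic : basic_coalgebra C).
Implicit Types T : comodule C.

(** Gives sums the shape required by the independence clause of [is_direct_sum]. The value 0 off [s]
    lets the induction open a new component. *)
Lemma sum_by_component (V : lmodType K) (J : eqType) (N : J -> submodClosed V)
    (l : seq V) :
  (forall x, x \in l -> exists j, x \in N j) ->
  exists (s : seq J) (v : J -> V), [/\ uniq s, forall j, v j \in N j,
    forall j, j \notin s -> v j = 0 & \sum_(x <- l) x = \sum_(j <- s) v j].
Proof.
elim: l => [|x l IH] hl.
  exists [::], (fun=> 0); split=> // [j|]; first exact: rpred0.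
  by rewrite !big_nil.
have [|s [v [us vN v0 sE]]] := IH.
  by move=> y yl; apply: hl; rewrite inE yl orbT.
have [j xj] := hl x (mem_head _ _).
pose v' k := v k + (if k == j then x else 0).
have v'N k : v' k \in N k.
  by apply: rpredD => //; case: eqP => [->//|_]; exact: rpred0.
have sum1 t : uniq t -> j \in t -> \sum_(k <- t) (if k == j then x else 0) = x.
  move=> ut jt; rewrite (bigD1_seq j) //= eqxx big1 ?addr0 // => k.
  by move=> /negPf->.
have [js|js] := boolP (j \in s).
  exists s, v'; split=> // [k ks|].
    rewrite /v' v0 // add0r; case: eqP => // kj.
    by rewrite kj js in ks.
  by rewrite big_cons sE big_split /= sum1 // addrC.
exists (j :: s), v'; split=> //= [|k|]; first by rewrite js.
  by rewrite inE negb_or /v' => /andP[/negPf-> /v0->]; rewrite addr0.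
rewrite big_cons sE big_split /= sum1 ?mem_head ?/= ?js // big_cons v0 //.
by rewrite add0r addrC.
Qed.

(* The components in soc C of a generator of T generate simple comodules
   isomorphic to T, and basicness leaves room for only one of them. *)
Lemma simple_image_eq T (f g : chom T (regular_comod C)) : simple_comod T ->
  injective f -> injective g -> forall t, exists t', f t' = g t.
Proof.
move=> sT fi gi; have [J [N [sN isoN [socE indep]]]] := Cbasic.
have [t0 t0n] := sT.1.
have comp (h : chom T (regular_comod C)) : injective h ->
    exists j, comod_iso T (sub_comod (N j)) /\
    forall t, h t \in subcomod_sp (N j).
  move=> hi.
  have : h t0 \in socle (regular_comod C).
    apply/sumspP; exists [:: h t0]; rewrite big_seq1; split=> // x.
    rewrite inE => /eqP->; exists (imsp h); last by apply/imspP; exists t0.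
    by exists (im_subcomod h) => //; apply: simple_iso (im_iso hi) sT.
  rewrite socE => /sumspP[l [hl hE]].
  have [|s [v [us vN v0 sE]]] :=
      sum_by_component (N := fun j => subcomod_sp (N j)) (l := l).
    by move=> x /hl[_ [j ->] xj]; exists j.
  (* Projection to component [j] is colinear: by independence, a functional killing [t0] kills each
     [v j]. *)
  have isoT j : j \in s -> v j <> 0 -> comod_iso T (sub_comod (N j)).
    move=> js vj0.
    have [|phi phi0|th thE] :=
      @cyclic_factor _ _ T (sub_comod (N j)) t0 (Subsp (vN j)).
    - exact: simple_cyclic.
    - apply: subval_inj; rewrite sub_act /=.
      have := indep s (fun j => act phi (regular_comod C) (v j)) us; apply=> //.
        by move=> k; apply: (subcomod_act (@subcomodP _ _ _ (N k))).
      by rewrite -linear_sum -sE -hE -chom_act phi0 linear0.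
    - apply: (schur (f := th)) => //; exists t0; rewrite thE.
      by move=> /(congr1 (@subval _ _ _)).
  have [j [js vj0]] : exists j, j \in s /\ v j <> 0.
    apply: contrapT => /forallNP h0; apply: t0n; apply: hi.
    rewrite linear0 hE sE big_seq big1 // => j js.
    by apply: contrapT => vj0; exact: (h0 j).
  exists j; split; first exact: isoT.
  have ht0 : h t0 = v j.
    rewrite hE sE (bigD1_seq j) //= big_seq_cond big1 ?addr0 // => k /andP[ks kj].
    apply: contrapT => vk0; move/eqP: kj; apply; apply: isoN.
    exact: comod_iso_trans (comod_iso_sym (isoT k ks vk0)) (isoT j js vj0).
  move=> t; have [phi <-] := simple_cyclic sT t0n t.
  by rewrite chom_act ht0; apply: (subcomod_act (@subcomodP _ _ _ (N j))).
have [i [isoi fN]] := comp f fi; have [j [isoj gN]] := comp g gi.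
have ij : i = j.
  by apply: isoN; exact: comod_iso_trans (comod_iso_sym isoi) isoj.
rewrite -{j isoj}ij in gN.
have [|h hE] := @chom_lift _ _ _ _ _ (incl_chom (N i)) f (@subval_inj _ _ _).
  by move=> p; exists (Subsp (fN p)).
move=> t; have [|t' t'E] := simple_surj (sN i) (f := h) _ (Subsp (gN t)).
  exists t0 => ht0; apply: t0n; apply: fi.
  by rewrite -hE ht0 !linear0.
by exists t'; rewrite -hE t'E.
Qed.

Section CoefficientMap.
Variables (T : comodule C) (phi : {scalar T}).

Lemma coef_is_chom :
  @is_chom K C T (regular_comod C) (lcontr C phi \o coact T).
Proof.
apply: act_is_chom => psi t.
by rewrite /= coact_act tmap_lcontr.
Qed.
Definition coef_chom : chom T (regular_comod C) := Chom coef_is_chom.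

Lemma scalar_coef (psi : {scalar C}) t : psi (coef_chom t) = phi (act psi T t).
Proof. by rewrite /coef_chom /act /= lrcontr. Qed.

Lemma counit_coef t : counit C (coef_chom t) = phi t.
Proof. by rewrite scalar_coef act_counit. Qed.

End CoefficientMap.

Lemma counit_rhit (e : {scalar C}) c : counit C (rhit e c) = e c.
Proof.
by rewrite -convE /conv /= counit_comulr.
Qed.

(* For phi in T^*, t |-> phi(t_0) t_1 embeds T into C as a subcomodule on which
   the idempotent endomorphism c |-> c e is 0 or the identity, so phi o e is 0 or
   phi; the same alternative then holds for all phi, as phi + psi shows. *)
Lemma simple_dichotomy (e : idem C) T : simple_comod T ->
  (forall t, act e T t = 0) \/ (forall t, act e T t = t).
Proof.
move=> sT.
have per (phi : {scalar T}) : (forall t, phi (act e T t) = 0) \/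
    (forall t, phi (act e T t) = phi t).
  have [phi0|] := EM (forall t, phi t = 0); first by left=> t; exact: phi0.
  move=> /existsNP[t0 phi0].
  set f := coef_chom phi; set h := chom_comp (rhit_chom e) f.
  have fi : injective f.
    apply: simple_inj => //; exists t0 => ft0; apply: phi0.
    by rewrite -counit_coef ft0 linear0.
  have hE t : counit C (h t) = phi (act e T t).
    rewrite -scalar_coef; exact: counit_rhit.
  have [h0|] := EM (forall t, h t = 0); first by left=> t; rewrite -hE h0 linear0.
  move=> /existsNP[t1 h1]; right=> t.
  have hi : injective h by apply: simple_inj => //; exists t1.
  (* [f t] has the form (f t') e, hence is fixed by c |-> c e. *)
  have [t' t'E] := simple_image_eq sT hi fi t.
  have -> : phi (act e T t) = counit C (h t) by rewrite hE.
  rewrite -counit_coef -t'E; congr (counit C _).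
  by transitivity (rhit e (f t)) => //; rewrite -t'E; exact: rhitK.
have [e0|] := EM (forall t, act e T t = 0); first by left.
move=> /existsNP[t0 et0]; right; apply: contrapT => /existsNP[s0 es0].
have [phi phi0] := exists_scalar et0.
have [|psi psi0] := @exists_scalar K T (s0 - act e T s0).
  by move=> /eqP; rewrite subr_eq0 => /eqP E; apply: es0.
(* [phi] sees that e is not 0 on [T] and [psi] that it is not the identity. So phi e = phi and psi e
   = 0, and phi + psi satisfies neither alternative. *)
have phiE : forall t, phi (act e T t) = phi t.
  by case: (per phi) => // /(_ t0).
have psiE : forall t, psi (act e T t) = 0.
  by case: (per psi) => // E; case: psi0; rewrite linearB E subrr.
case: (per (phi \+ psi)) => [/(_ t0)/=|/(_ s0) /=].
  by rewrite psiE addr0.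
rewrite phiE psiE addr0 => E; apply: psi0; rewrite linearB psiE subr0.
by apply: (addrI (phi s0)); rewrite -E addr0.
Qed.

End Basic.

(** * Extensions *)

Section Extensions.
Variables (K : fieldType) (C : coalgebra K).
Implicit Types A B : comodule C.

Definition dsum_inr A B : chom B (dsum_comod A B) :=
  @Chom K C B (dsum_comod A B) (dsum_inr_lin A B) (@dsum_coact_inr K C A B).

Definition has_section (A X : comodule C) (p : chom X A) : Prop :=
  exists s : chom A X, forall a, p (s a) = a.

(** An equivalence restricts on A to a section; conversely a section [s] gives the equivalence (b,
    a) |-> ext_in b + s a. *)
Lemma ext_trivialP A B (X : extension A B) :
  ext_equiv (trivial_ext A B) X <-> has_section (ext_out X).
Proof.
split=> [[h [hin hout]]|[s sK]].
  exists (chom_comp h (dsum_inr B A)) => a.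
  exact: (hout (0, a)).
pose hl : {linear (B * A)%type -> X} :=
  (ext_in X \o dsum_fst_lin B A) \+ (s \o dsum_snd_lin B A).
have hinl b : hl (dsum_inl_lin B A b) = ext_in X b by rewrite /hl /= linear0 addr0.
have hinr a : hl (dsum_inr_lin B A a) = s a by rewrite /hl /= linear0 add0r.
have hc : @is_chom K C (dsum_comod B A) X hl.
  apply: act_is_chom => phi.
  apply: (dsum_ext (f := hl \o act phi (dsum_comod B A))
    (g := act phi X \o hl)) => [b|a].
    transitivity (hl (dsum_inl_lin B A (act phi B b))).
      congr (hl _); exact: esym (chom_act (dsum_inl B A) phi b).
    rewrite hinl chom_act; congr (act phi X _); exact: esym (hinl b).
  transitivity (hl (dsum_inr_lin B A (act phi A a))).
    congr (hl _); exact: esym (chom_act (dsum_inr B A) phi a).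
  rewrite hinr chom_act; congr (act phi X _); exact: esym (hinr a).
exists (Chom hc); split=> [b|[b a]]; first exact: hinl.
rewrite /= linearD sK.
by have -> : ext_out X (ext_in X b) = 0; [apply/ext_exact; exists b|rewrite add0r].
Qed.

Lemma Ext1_neq0P A B :
  Ext1_neq0 A B <-> exists X : extension A B, ~ has_section (ext_out X).
Proof. by split=> [[X hX]|[X hX]]; exists X => /ext_trivialP. Qed.

(** The map x |-> x - ext_in (r x) vanishes on B, and its factorization through A is the section. *)
Lemma retraction_section A B (X : extension A B) (r : chom X B) :
  (forall b, r (ext_in X b) = b) -> has_section (ext_out X).
Proof.
move=> rK.
have ac : is_chom (idfun \- (ext_in X \o r)).
  apply: act_is_chom => phi x.
  transitivity (act phi X x - ext_in X (r (act phi X x))); first by [].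
  by rewrite 2!chom_act -linearB.
have [|m m0|s sE] := @chom_factor _ _ _ _ _ (ext_out X) (Chom ac).
- exact: ext_out_surj.
- have /ext_exact[b <-] := m0.
  by rewrite /= rK subrr.
exists s => a; have [x <-] := ext_out_surj X a.
rewrite sE /= linearB.
by rewrite (_ : ext_out X (ext_in X _) = 0) ?subr0 //; apply/ext_exact; exists (r x).
Qed.

(** The middle comodule stays; only the two outer maps change. *)
Lemma Ext1_iso A A' B B' : comod_iso A A' -> comod_iso B B' ->
  Ext1_neq0 A B -> Ext1_neq0 A' B'.
Proof.
move=> /comod_isoP[f [f' [fK f'K]]] /comod_isoP[g [g' [gK g'K]]].
move=> /Ext1_neq0P[X nX]; apply/Ext1_neq0P.
have ii : injective (chom_comp (ext_in X) g').
  by move=> x y /ext_in_inj/(can_inj g'K).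
have os a : exists x, chom_comp f (ext_out X) x = a.
  by have [x xE] := ext_out_surj X (f' a); exists x; rewrite /= xE f'K.
have ex x : chom_comp f (ext_out X) x = 0 <->
    exists b, chom_comp (ext_in X) g' b = x.
  split=> [h|[b <-]].
    have /ext_exact[b <-] : ext_out X x = 0 by rewrite -[LHS]fK [f _]h linear0.
    by exists (g b); rewrite /= gK.
  rewrite /= (_ : ext_out X _ = 0) ?linear0 //; apply/ext_exact.
  by exists (g' b).
exists (Extension ii os ex) => -[s sK]; apply: nX.
exists (chom_comp s f) => a.
by rewrite -[LHS]fK; have /= -> := sK (f a); rewrite fK.
Qed.

End Extensions.

(** * Vanishing of e C^* (1 - e), and injective envelopes *)

Section Implications.
Variables (K : fieldType) (C : coalgebra K) (e : idem C).
Implicit Types M N T : comodule C.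

(* As f M = {m | e m = 0} for f = 1 - e, this says that f M is a subcomodule. *)
Definition corner_vanishes M : Prop :=
  forall phi m, act e M (act phi M (act (idem_compl e) M m)) = 0.

Lemma envelope_act_e M E : corner_vanishes E ->
  injective_envelope M E -> (forall m, act e M m = m) -> forall m, act e E m = m.
Proof.
move=> h [_ [i [ii ess]]] eM m; apply: contrapT => em.
have kc : is_subcomod (kersp (act e E)).
  apply: act_is_subcomod => phi n /kerspP en; apply/kerspP.
  by have := h phi n; rewrite act_compl en subr0.
have [|s /kerspP is0] := ess (Subcomod kc).
  exists (act (idem_compl e) E m); first by apply/kerspP; exact: act_e_compl.
  rewrite act_compl => /eqP; rewrite subr_eq0 => /eqP E1; exact/em/esym.
by case; rewrite -[s]eM chom_act.
Qed.

(** The image of [f] is fixed by e; if nonzero, it meets [T], which e kills. *)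
Lemma hom_envelope0 T E M (f : chom E M) : (forall m, act e E m = m) ->
  injective_envelope T M -> (forall t, act e T t = 0) -> forall m, f m = 0.
Proof.
move=> eE [_ [i [ii ess]]] eT m; apply: contrapT => fm0.
have [|t /imspP[n nE] it0] := ess (im_subcomod f).
  by exists (f m) => //; apply/imspP; exists m.
by apply: it0; rewrite -nE -[n]eE chom_act nE -chom_act eT linear0.
Qed.

(* The extension X of T by L maps to E; since X does not split, this map is
   injective, so that X -> T -> F extends to E. *)
Lemma nonsplit_hom T E F (L : subcomod E) (i : chom T F) : simple_comod T ->
  injective_comod E -> injective_comod F -> injective i ->
  Ext1_neq0 T (sub_comod L) -> exists (h : chom E F) m, h m <> 0.
Proof.
move=> sT injE injF ii /Ext1_neq0P[X nX].
have [g gE] := injE _ _ (ext_in X) (incl_chom L) (@ext_in_inj _ _ _ _ X).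
have gi : injective g.
  apply: contrapT => gi; apply: nX.
  have [x gx0 x0] : exists2 x, g x = 0 & x <> 0.
    apply: contrapT => h; apply/gi/inj_lin => x gx0; apply: contrapT => x0.
    by apply: h; exists x.
  (* The kernel of [g] meets the copy of [L] trivially, so it embeds in the simple [T]; being
     nonzero it maps isomorphically, and the inverse is a section. *)
  pose p := chom_comp (ext_out X) (incl_chom (ker_subcomod g)).
  have pk k : p k = 0 -> k = 0.
    move=> /ext_exact[b bE]; apply: subval_inj.
    have /kerspP := subvalP k; rewrite -[subval k]bE gE => b0.
    by rewrite (_ : b = 0) ?linear0 //; exact: subval_inj.
  have [|s [_ sK]] := chom_inv (inj_lin pk).
    apply: simple_surj => //; have xk : x \in kersp g by apply/kerspP.
    by exists (Subsp xk) => /pk/(congr1 (@subval _ _ _)).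
  by exists (chom_comp (incl_chom (ker_subcomod g)) s).
have [h hE] := injF _ _ g (chom_comp i (ext_out X)) gi.
have [[t t0] _] := sT; have [x xE] := ext_out_surj X t.
exists h, (g x); rewrite hE /= xE => it0; apply: t0; apply: ii.
by rewrite it0 linear0.
Qed.

(** By essentiality every simple subcomodule of [E] meets the image of [T], hence lies in it. *)
Lemma socle_envelope_iso T E : simple_comod T -> injective_envelope T E ->
  comod_iso T (sub_comod (socle E)).
Proof.
move=> sT [_ [i [ii ess]]].
have imsoc t : i t \in socle E.
  apply/sumspP; exists [:: i t]; rewrite big_seq1; split=> // x.
  rewrite inE => /eqP->; exists (imsp i); last by apply/imspP; exists t.
  by exists (im_subcomod i) => //; apply: simple_iso (im_iso ii) sT.
have [|h hE] := @chom_lift _ _ _ _ _ (incl_chom (socle E)) i (@subval_inj _ _ _).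
  by move=> p; exists (Subsp (imsoc p)).
exists h; apply: bij_lin => [x y hxy|w]; first by apply: ii; rewrite -!hE hxy.
suff /imspP[t tE] : subval w \in imsp i.
  by exists t; apply: subval_inj; rewrite -tE -hE.
have /sumspP[l [hl ->]] := subvalP w; rewrite big_seq; apply: rpred_sum => x.
move=> /hl[_ [N <- sN] xN].
have [|t itN it0] := ess N.
  have [[n n0] _] := sN; exists (subval n); first exact: subvalP.
  by move=> n00; apply: n0; exact: subval_inj.
have [h0|h1] := sN.2 (preim_subcomod (incl_chom N) (im_subcomod i)).
  case: it0; apply: (congr1 (@subval _ _ _) (h0 (Subsp itN) _)).
  by rewrite in_preimsp; apply/imspP; exists t.
by have := h1 (Subsp xN); rewrite in_preimsp.
Qed.

Section Key.
Hypothesis dichotomy : forall T, simple_comod T ->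
  (forall t, act e T t = 0) \/ (forall t, act e T t = t).
Hypothesis no_ext : forall T Y, simple_comod T -> simple_comod Y ->
  (forall t, act e T t = t) -> (forall y, act e Y y = 0) -> ~ Ext1_neq0 Y T.

Lemma corner_quot M (N : subcomod M) : corner_vanishes (quot_comod N) ->
  forall phi m, act e M (act phi M (act (idem_compl e) M m)) \in subcomod_sp N.
Proof.
move=> h phi m; rewrite -qproj_eq0; apply/eqP.
have := h phi (qproj N m).
by rewrite -!(chom_act (qproj_chom N)).
Qed.

(* Either M has a nonzero subcomodule N killed by e, and induction applies to
   M/N, or every simple T in M is fixed by e. Then W = {m | e m \in T} is a
   subcomodule by induction on M/T, and e kills W/T: a simple subcomodule Y of
   W/T would give an extension of Y by T, hence by splitting a copy of Y in M. *)
Lemma spanned_corner_vanishes n M : spanned_by n M -> corner_vanishes M.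
Proof.
elim/ltn_ind: n M => n IH M Mn.
have Pquot (N : subcomod M) x : x \in subcomod_sp N -> x <> 0 ->
    corner_vanishes (quot_comod N).
  move=> xN x0.
  have [||k kn hk] := spanned_by_proper (h := qproj N) Mn _ _ x0.
  - exact: qproj_surj.
  - by apply/eqP; rewrite qproj_eq0.
  exact: IH k kn (quot_comod N) hk.
have [[N [x xN x0] eN]|noN] := EM (exists2 N : subcomod M,
    exists2 x, x \in subcomod_sp N & x <> 0 &
    forall x, x \in subcomod_sp N -> act e M x = 0).
  (* The element is fixed by e and lies in [N], which e kills. *)
  move=> phi m; rewrite -[LHS]actK; apply: eN.
  by apply: corner_quot; exact: Pquot xN x0.
have [M0|M0] := EM (nonzero M); last first.
  move=> phi m; apply: contrapT => h; apply: M0.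
  by exists (act e M (act phi M (act (idem_compl e) M m))).
have [T [t [sT ti]]] := has_simple M0.
have [t0 t00] := sT.1.
have tt0 : t t0 <> 0 by move=> tt0; apply: t00; apply: ti; rewrite tt0 linear0.
have eT : forall s, act e T s = s.
  have [eT|//] := dichotomy sT; case: noN; exists (im_subcomod t).
    by exists (t t0) => //; apply/imspP; exists t0.
  by move=> _ /imspP[s <-]; rewrite -chom_act eT linear0.
have PT : corner_vanishes (quot_comod (im_subcomod t)).
  by apply: (Pquot _ (t t0)) => //; apply/imspP; exists t0.
pose W := preimsp (act e M) (imsp t).
have Wc : is_subcomod W.
  apply: act_is_subcomod => phi w; rewrite !in_preimsp => ew.
  (* Split w = e w + (1 - e) w: the first part lies in [T], and the condition on M/T handles the
     second. *)
  rewrite -[w](subrK (act e M w)) addrC linearD -act_compl [act e M _]linearD.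
  apply: rpredD; last exact: corner_quot PT phi w.
  have /imspP[s sE] := subcomod_act (imsp_is_subcomod (f := t)) phi ew.
  by rewrite -sE -chom_act; apply/imspP; exists (act e T s).
have tW s : t s \in W.
  by rewrite in_preimsp -chom_act; apply/imspP; exists (act e T s).
have [WT|] := EM (forall w, w \in W -> w \in imsp t).
  (* (1 - e) m lies in [W], hence in [T], where e is the identity; but e kills it. *)
  move=> phi m; have /imspP[s sE] : act (idem_compl e) M m \in imsp t.
    by apply: WT; rewrite in_preimsp act_e_compl rpred0.
  suff -> : act (idem_compl e) M m = 0 by rewrite !linear0.
  by rewrite -sE -[s]eT chom_act sE act_e_compl.
move=> /existsNP[w /not_implyP[wW wT]].
have [|t' t'E] := @chom_lift _ _ _ _ _ (incl_chom (Subcomod Wc)) t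
    (@subval_inj _ _ _).
  by move=> p; exists (Subsp (tW p)).
pose Q := quot_comod (im_subcomod t').
have eQ q : act e Q q = 0.
  have [v <-] := qproj_surj q; rewrite -(chom_act (qproj_chom (im_subcomod t'))).
  apply/eqP; rewrite qproj_eq0.
  have := subvalP v; rewrite in_preimsp => /imspP[s sE].
  apply/imspP; exists s; apply: subval_inj.
  by rewrite sub_act -sE -t'E.
have [|Y [y [sY yi]]] := @has_simple _ _ Q.
  exists (qproj (im_subcomod t') (Subsp wW)) => /eqP.
  rewrite qproj_eq0 => /imspP[s sE]; apply: wT; apply/imspP; exists s.
  by rewrite -t'E sE.
have eY z : act e Y z = 0 by apply: yi; rewrite chom_act eQ linear0.
(* The preimage of [Y] in [W] is an extension of [Y] by [T], with maps [j] and [p]. *)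
pose V := preim_subcomod (qproj_chom (im_subcomod t')) (im_subcomod y).
have t'V s : t' s \in subcomod_sp V.
  apply/imspP; exists 0; rewrite linear0; apply/esym/eqP; rewrite qproj_eq0.
  by apply/imspP; exists s.
have [|j jE] := @chom_lift _ _ _ _ _ (incl_chom V) t' (@subval_inj _ _ _).
  by move=> p; exists (Subsp (t'V p)).
have [|p pE] := @chom_lift _ _ _ _ _ y
    (chom_comp (qproj_chom (im_subcomod t')) (incl_chom V)) yi.
  by move=> v; have /imspP := subvalP v.
have ypE v : y (p v) = qproj (im_subcomod t') (subval v) by exact: pE.
have ji : injective j.
  by move=> a b jab; apply: ti; rewrite -!t'E -!jE jab.
have ps z : exists v, p v = z.
  have [v vE] := qproj_surj (y z).
  have vV : v \in subcomod_sp V by apply/imspP; exists z.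
  by exists (Subsp vV); apply: yi; rewrite pE -vE.
have ex v : p v = 0 <-> exists b, j b = v.
  split=> [pv|[b <-]].
    have /eqP : qproj (im_subcomod t') (subval v) = 0.
      by rewrite -ypE pv linear0.
    rewrite qproj_eq0 => /imspP[s sE]; exists s; apply: subval_inj.
    by rewrite -sE -jE.
  apply: yi; rewrite ypE linear0; apply/eqP; rewrite qproj_eq0.
  by apply/imspP; exists b; exact: esym (jE b).
have [s sK] : has_section p.
  apply: contrapT => ns; apply: (no_ext sT sY eT eY).
  by apply/Ext1_neq0P; exists (Extension ji ps ex).
(* The section embeds [Y] in [M], where e kills no nonzero subcomodule. *)
pose g := chom_comp (incl_chom (Subcomod Wc)) (chom_comp (incl_chom V) s).
have [z z0] := sY.1.
case: noN; exists (im_subcomod g); last first.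
  by move=> _ /imspP[u <-]; rewrite -chom_act eY linear0.
exists (g z); first by apply/imspP; exists z.
move=> gz0; apply: z0; rewrite -[z]sK (_ : s z = 0) ?linear0 //.
by apply/subval_inj/subval_inj.
Qed.

(** The condition at [m] can be checked in the finite-dimensional subcomodule C^* m. *)
Lemma corner_vanishesT M : corner_vanishes M.
Proof.
move=> phi m; have [n hn] := dual_orbit_spanned m.
have := spanned_corner_vanishes hn phi (Subsp (dual_orbit_id m)).
by move=> /(congr1 (@subval _ _ _)); rewrite !sub_act.
Qed.

End Key.
End Implications.

(** * The unit of the adjunction between T and S *)

Lemma tmap_injr (K : fieldType) (U V W : lmodType K) (g : {linear V -> W}) :
  injective g -> injective (tmap (idfun : {linear U -> U}) g).
Proof.
move=> /left_inverse_lin[r rK]; apply: (can_inj (g := tmap idfun r)) => x.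
by rewrite tmap_comp -[RHS]tmap_id; apply: tmap_eq => // v; exact: rK.
Qed.

Section Unit.
Variables (K : fieldType) (C : coalgebra K) (e : idem C).

Lemma Ce_lcoactE c :
  Ce_lcoact e (to_Ce e c) = tmap (to_eCe e) (to_Ce e) (comul C c).
Proof.
transitivity (tmap (to_eCe e) (to_Ce e) (comul C (rhit e c))); first by [].
rewrite comul_rhit tmap_comp; apply: tmap_eq => // u.
by apply: subval_inj; exact: bihit_rhit.
Qed.

Definition Ce_counit : {scalar Ce e} := counit C \o incl (Ce_sp e).

Lemma Ce_counitE c : Ce_counit (to_Ce e c) = e c.
Proof. exact: counit_rhit. Qed.

Lemma Ce_lcoact_counit y :
  rcontr (eCe e) Ce_counit (Ce_lcoact e y) = to_eCe e (subval y).
Proof.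
have [c <-] := corestr_surj y; rewrite [X in rcontr _ _ X]Ce_lcoactE.
transitivity (rcontr _ Ce_counit
    (tmap idfun (to_Ce e) (tmap (to_eCe e) idfun (comul C c)))).
  by rewrite tmap_comp; congr (rcontr _ _ _); apply: tmap_eq.
rewrite rcontr_tmap tmap_rcontr.
transitivity (to_eCe e (lhit e c)).
  by congr (to_eCe e _); apply: rcontr_eq => d; exact: Ce_counitE.
transitivity (to_eCe e c); first by apply: subval_inj; exact: bihit_lhit.
by apply: subval_inj; exact: esym (bihit_rhit e c).
Qed.

(** Contract the last tensor factor of the cotensor equation with the counit. *)
Lemma cotens_counit (N : comodule (eCe e)) (z : N ⊗ Ce e) :
  cotens_map N z = 0 ->
  coact N (rcontr N Ce_counit z) = tmap idfun (to_eCe e \o incl (Ce_sp e)) z.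
Proof.
move=> z0.
have zE : tassoc N (eCe e) (Ce e) (tmap (coact N) idfun z)
        = tmap idfun (Ce_lcoact e) z.
  by apply/eqP; rewrite -subr_eq0; apply/eqP; exact: z0.
rewrite -tmap_rcontr -rcontr_assoc zE tmap_comp; apply: tmap_eq => // y.
exact: Ce_lcoact_counit.
Qed.

Section Adjoint.
Variables (X : comodule C) (N : comodule (eCe e)) (p : {linear X -> N}).
(** Equivalently, [p] is v |-> e v followed by a comodule map T(X) -> N. *)
Hypothesis pP : forall v, coact N (p v) = tmap p (to_eCe e) (coact X v).

(* For N = T(M) and p = e this is the unit M -> S(T(M)). *)
Definition unit_map : {linear X -> N ⊗ Ce e} := tmap p (to_Ce e) \o coact X.

(** By coassociativity both terms of [cotens_map] apply [p], [to_eCe] and [to_Ce] to the factors of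
    the twofold coaction. *)
Lemma unit_map_cotens v : cotens_map N (unit_map v) = 0.
Proof.
apply/eqP; rewrite subr_eq0; apply/eqP.
transitivity (tmap p (tmap (to_eCe e) (to_Ce e))
    (tmap idfun (comul C) (coact X v))).
  rewrite -coactA -tassoc_nat; congr (tassoc _ _ _ _).
  by rewrite !tmap_comp; apply: tmap_eq => // u; exact: pP.
rewrite !tmap_comp; apply: tmap_eq => // c; exact: esym (Ce_lcoactE c).
Qed.

Lemma unit_map_is_chom : @is_chom K C X (tens_comod N (Ce e)) unit_map.
Proof.
apply: tens_is_chom => v.
transitivity (tmap p (tmap (to_Ce e) idfun)
    (tmap idfun (comul C) (coact X v))).
  by rewrite !tmap_comp; apply: tmap_eq => // c; exact: coact_to_Ce.
rewrite -coactA -tassoc_nat; congr (tassoc _ _ _ _).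
by rewrite !tmap_comp; apply: tmap_eq.
Qed.

Lemma unit_chom : exists u : chom X (section_functor N),
  forall v, subval (u v) = unit_map v.
Proof.
have [|u uE] := @chom_lift _ _ _ _ _
    (incl_chom (ker_subcomod (Chom (@cotens_map_is_chom _ _ _ N))))
    (Chom unit_map_is_chom) (@subval_inj _ _ _).
  move=> v; have vk : unit_map v \in kersp (cotens_map N).
    by apply/kerspP; exact: unit_map_cotens.
  by exists (Subsp vk).
by exists u.
Qed.

Lemma unit_map_counit v :
  rcontr N Ce_counit (unit_map v) = p (act e X v).
Proof.
rewrite -tmap_rcontr /unit_map /=.
transitivity (rcontr N Ce_counit
    (tmap idfun (to_Ce e) (tmap p idfun (coact X v)))).
  by rewrite tmap_comp; congr (rcontr _ _ _); apply: tmap_eq.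
rewrite rcontr_tmap; apply: rcontr_eq => c; exact: Ce_counitE.
Qed.

End Adjoint.

Lemma to_eM_adjoint (M : comodule C) (m : M) :
  coact (quotient_functor e M) (to_eM e M m) =
  tmap (to_eM e M) (to_eCe e) (coact M m).
Proof. exact: eM_coactE. Qed.

Lemma tmap_act_coact (M : comodule C) phi (m : M) :
  tmap (act phi M) idfun (coact M m) = tmap idfun (rhit phi) (coact M m).
Proof.
transitivity (tmap (rcontr M phi) idfun (tmap (coact M) idfun (coact M m))).
  by rewrite tmap_comp; apply: tmap_eq.
by rewrite -mcontr_assoc coactA tmap_comp; apply: tmap_eq.
Qed.

(** The counit recovers [p m] from the unit at [m], whence injectivity. For surjectivity, N ⊗ Ce
    embeds in N ⊗ eCe when Ce = eCe, and there an element of the cotensor product becomes the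
    coaction of its contraction [n]. *)
Lemma section_iso (M : comodule C) : right_semicentral e ->
  (forall m, act e M m = m) -> comod_iso M (section_functor (quotient_functor e M)).
Proof.
move=> sc eM.
pose p : {linear M -> quotient_functor e M} := to_eM e M.
have [u uE] := @unit_chom _ _ p (@to_eM_adjoint M).
have pi : injective p.
  by move=> x y /(congr1 (@subval _ _ _)) E; rewrite -[x]eM -[y]eM; exact: E.
exists u; apply: bij_lin.
  move=> x y uxy; apply: pi; rewrite -[x]eM -[y]eM -!(unit_map_counit p).
  by rewrite -!uE uxy.
move=> z.
pose j := to_eCe e \o incl (Ce_sp e).
have jE (w : subsp (Ce_sp e)) : subval (j w) = subval w.
  have := subvalP w; rewrite sc => /imspP[c cE].
  transitivity (bihit e (subval w)); first by [].
  by rewrite -cE; exact: bihitK.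
have ji : injective j.
  by move=> x y jxy; apply: subval_inj; rewrite -jE jxy jE.
pose n := rcontr _ Ce_counit (subval z).
have [m mn] := corestr_surj n.
exists m; apply: subval_inj; rewrite uE.
apply: (tmap_injr ji).
transitivity (coact (quotient_functor e M) n).
  rewrite -mn [RHS]to_eM_adjoint /unit_map /= tmap_comp; apply: tmap_eq => // c.
  by apply: subval_inj; exact: bihit_rhit.
by apply: cotens_counit; apply/kerspP; exact: subvalP z.
Qed.

(** As e kills A, it maps X into B. This gives a map X -> S(T(B)) = B whose restriction [g] to B is
    nonzero, hence invertible as B is simple; the inverse of [g] turns the map into a retraction. *)
Lemma section_splits (B A : comodule C) (X : extension A B) :
  simple_comod B -> (forall b, act e B b = b) -> (forall a, act e A a = 0) ->
  comod_iso (section_functor (quotient_functor e B)) B -> has_section (ext_out X).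
Proof.
move=> sB eB eA /comod_isoP[k [k' [kK k'K]]].
have [r rK] := left_inverse_lin (@ext_in_inj _ _ _ _ X).
have rE x : ext_in X (r (act e X x)) = act e X x.
  have /ext_exact[b <-] : ext_out X (act e X x) = 0 by rewrite chom_act eA.
  by rewrite rK.
pose h := r \o act e X.
pose p : {linear X -> quotient_functor e B} := to_eM e B \o h.
have pP x : coact (quotient_functor e B) (p x) = tmap p (to_eCe e) (coact X x).
  rewrite [LHS]to_eM_adjoint.
  have -> : coact B (h x) = tmap r (lhit e) (coact X x).
    transitivity (tmap r idfun (tmap (ext_in X) idfun (coact B (h x)))).
      rewrite tmap_comp -[LHS]tmap_id; apply: tmap_eq => // b.
      exact: esym (rK b).
    by rewrite -chomP /= rE coact_act tmap_comp; apply: tmap_eq.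
  rewrite tmap_comp.
  (* [to_eCe] does not distinguish [lhit e] from [rhit e], and the latter moves across the tensor to
     the action of e on X. *)
  transitivity (tmap (to_eM e B \o r) (to_eCe e) (tmap idfun (rhit e) (coact X x))).
    rewrite tmap_comp; apply: tmap_eq => // c; apply: subval_inj.
    exact: etrans (bihit_lhit e c) (esym (bihit_rhit e c)).
  by rewrite -tmap_act_coact tmap_comp; apply: tmap_eq.
have [u uE] := unit_chom pP.
pose g := chom_comp (chom_comp k u) (ext_in X).
have [b0 b00] := sB.1.
have g0 : g b0 <> 0.
  move=> g0; have u0 : u (ext_in X b0) = 0 by rewrite -[LHS]kK [k _]g0 linear0.
  have := unit_map_counit p (ext_in X b0); rewrite -uE u0 linear0.
  move=> p0; apply: b00.
  have <- : subval (p (act e X (ext_in X b0))) = b0.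
    transitivity (act e B (r (act e X (act e X (ext_in X b0))))) => //.
    by rewrite actK -chom_act eB rK eB.
  by rewrite -p0.
have [|b|g' [gK g'K]] := @chom_inv _ _ _ _ g.
- by apply: simple_inj => //; exists b0.
- by apply: simple_surj => //; exists b0.
apply: (@retraction_section _ _ _ _ X (chom_comp g' (chom_comp k u))) => b.
exact: gK.
Qed.

End Unit.

(** * Semicentral idempotents and torsion subcomodules *)

Section Semicentral.
Variables (K : fieldType) (C : coalgebra K) (e : idem C).

Lemma conv_compl (phi : {scalar C}) c :
  conv e (conv phi (idem_compl e)) c = phi (lhit (idem_compl e) (rhit e c)).
Proof. exact: convE. Qed.

Lemma lhit_compl c : lhit (idem_compl e) c = c - lhit e c.
Proof. exact: (@act_compl _ _ e (regular_comod C) c). Qed.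

(** The functional e phi (1 - e) sends c to [phi] of (1 - e)(c e). It vanishes for all [phi] exactly
    when every c e is fixed by [lhit e], that is, when Ce is contained in eCe. *)
Lemma right_semicentralP : right_semicentral e <->
  forall M : comodule C, corner_vanishes e M.
Proof.
split=> [sc M phi m|h c].
  (* The right-hand 0 is written as the action of the functional e - e. *)
  rewrite (act_conv phi) act_conv -[RHS](subrr (act e M m)) -actN.
  apply: rcontr_eq => c.
  rewrite conv_compl lhit_compl; transitivity (0 : K); last exact/esym/subrr.
  have : rhit e c \in eCe_sp e by rewrite -sc; exact: in_imsp.
  move=> /imspP[d <-]; rewrite -[lhit e (bihit e d)]/(lhit e (lhit e (rhit e d))).
  by rewrite lhitK subrr linear0.
apply/imspP/imspP => -[d <-].
  exists d; apply/esym/eqP; rewrite -subr_eq0 -[bihit e d]/(lhit e (rhit e d)).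
  rewrite -lhit_compl; apply/eqP; apply: contrapT => /exists_scalar[phi]; apply.
  rewrite -conv_compl -counit_lhit.
  transitivity (counit C
    (act (conv e (conv phi (idem_compl e))) (regular_comod C) d)).
    by [].
  by rewrite -act_conv -(act_conv phi) h linear0.
(* eCe always lies in Ce, as the two hits commute. *)
by exists (lhit e d); rewrite -lhit_rhit.
Qed.

(** As a space (1 - e)M is the kernel of e, so it contains every torsion subcomodule; only its
    stability under C^* is in question. *)
Lemma torsion_subcomodP :
  (forall M : comodule C, is_torsion_subcomod e (eM_sp (idem_compl e) M)) <->
  forall M : comodule C, corner_vanishes e M.
Proof.
split=> [h M phi m|h M].
  have [hN _] := h M.
  have /imspP[n <-] := subcomod_act hN phi (in_imsp _ m).
  exact: act_e_compl.
have imE m : act e M m = 0 -> m \in eM_sp (idem_compl e) M.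
  by move=> em; apply/imspP; exists m; rewrite act_compl em subr0.
have hN : is_subcomod (eM_sp (idem_compl e) M).
  by apply: act_is_subcomod => phi _ /imspP[m <-]; apply: imE; exact: h.
exists hN; split=> [|P /torsionP hP m mP].
  apply/torsionP => x; apply: subval_inj; rewrite sub_act.
  by have /imspP[m <-] := subvalP x; exact: act_e_compl.
apply: imE; have := congr1 (@subval _ _ _) (hP (Subsp mP)).
by rewrite sub_act.
Qed.

End Semicentral.

Theorem theorem6p2 (K : fieldType) (C : coalgebra K)
    (Cbasic : basic_coalgebra C)
    (I : Type) (S E : I -> comodule C)
    (Ssimple : complete_simples S)
    (Eenv : forall x, injective_envelope (S x) (E x))
    (Gconn : quiver_connected S)
    (e : idem C) :
  [<-> (* a *)
       stable_class (torsion (idem_compl e));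
       (* b *)
       forall x, torsion_free_vertex S e x -> T_full e (E x);
       (* c *)
       forall x y, torsion_free_vertex S e x -> ~ torsion_free_vertex S e y ->
         forall (f : chom (E x) (E y)) (m : E x), f m = 0;
       (* d *)
       forall x, torsion_free_vertex S e x ->
         ~ exists y, ~ torsion_free_vertex S e y /\ predecessor S E y x;
       (* e *)
       ~ exists y x, [/\ quiver_path S y x, T_full e (S x) & torsion e (S y)];
       (* f *)
       ~ exists y x, [/\ arrow S y x, T_full e (S x) & torsion e (S y)];
       (* g *)
       right_semicentral e;
       (* h *)
       forall M : comodule C, is_torsion_subcomod e (eM_sp (idem_compl e) M);
       (* i *)
       forall x, torsion_free_vertex S e x ->
         comod_iso (section_functor (quotient_functor e (S x))) (S x)].
Proof.
have [sS _ compl] := Ssimple.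
have dich T : simple_comod T -> _ := @simple_dichotomy K C Cbasic e T.
have free_id x : torsion_free_vertex S e x -> forall m, act e (S x) m = m.
  by move=> tx; have [/torsionP/tx|] := dich _ (sS x).
have not_free y : ~ torsion_free_vertex S e y -> forall m, act e (S y) m = 0.
  by move=> /contrapT/torsionP.
have torsion_not_free y : torsion e (S y) -> ~ torsion_free_vertex S e y.
  by move=> ty; apply.
have full_free x : T_full e (S x) -> torsion_free_vertex S e x.
  move=> /T_fullP full /torsionP tor; have [[m m0] _] := sS x.
  by apply: m0; rewrite -(full m) tor.
have free_full x : torsion_free_vertex S e x -> T_full e (S x).
  by move=> /free_id/T_fullP.
pose no_arrow := ~ exists y x, [/\ arrow S y x, T_full e (S x) & torsion e (S y)].
have fP : no_arrow -> forall M : comodule C, corner_vanishes e M.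
  move=> na; apply: corner_vanishesT dich _ => T Y sT sY eT eY ext.
  have [x Tx] := compl _ sT; have [y Yy] := compl _ sY.
  apply: na; exists y, x; split; first exact: Ext1_iso Yy Tx ext.
  - apply/free_full => /torsionP tor; have [[m m0] _] := sT; apply: m0.
    by rewrite -(eT m) (act_iso (comod_iso_sym Tx) tor).
  - by apply/torsionP; exact: act_iso Yy eY.
have df : (forall x, torsion_free_vertex S e x ->
    ~ exists y, ~ torsion_free_vertex S e y /\ predecessor S E y x) -> no_arrow.
  move=> d [y [x [yx fx ty]]]; apply: (d x (full_free _ fx)).
  exists y; split; first exact: torsion_not_free.
  (* The first Loewy term of E_x is S_x, so an arrow is a 1-predecessor. *)
  exists 1%N => //; apply: Ext1_iso yx; first by exists (chom_id _), id.
  exact: socle_envelope_iso.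
tfae.
- move=> a x /free_id fx; apply/T_fullP/torsion_complP.
  by apply: a (Eenv x); exact/torsion_complP.
- move=> b x y fx /not_free ty f m.
  exact: hom_envelope0 ((T_fullP _ _).1 (b x fx)) (Eenv y) ty m.
- move=> c x fx [y [ty [n _ ext]]].
  have [injy [i [ii _]]] := Eenv y.
  have [h [m hm]] := nonsplit_hom (sS y) (Eenv x).1 injy ii ext.
  by apply: hm; exact: c.
- move=> /df na [y [x [yx fx ty]]]; apply: (full_free _ fx).
  (* With no arrow from a torsion to a torsion-free vertex, torsion spreads from the source of a
     path to its end. *)
  elim: yx ty {fx} => {x y} [y x yx ty|//|x y z _ IH1 _ IH2 tx]; last exact/IH2/IH1.
  by apply: contrapT => fx; apply: na; exists y, x; split=> //; exact: free_full.
- move=> ne [y [x [yx fx ty]]]; apply: ne; exists y, x; split=> //.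
  exact: rt_step.
- by move=> /fP/right_semicentralP.
- by move=> /right_semicentralP/torsion_subcomodP.
- move=> /torsion_subcomodP/right_semicentralP sc x /free_id fx.
  exact: comod_iso_sym (section_iso sc fx).
(* The cycle closes through (f): the section functor splits every forbidden extension, and [fP] then
   applies to the envelope [F]. *)
- move=> i; have na : no_arrow.
    move=> [y [x [/Ext1_neq0P[X nX] fx /torsionP ty]]]; apply: nX.
    apply: section_splits ty _ => //; first exact/T_fullP.
    exact/i/full_free.
  move=> M F /torsion_complP eM envF; apply/torsion_complP.
  exact: envelope_act_e (fP na F) envF eM.
Qed.
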